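(* Let $n\ge3$ and $1\le k\le n$ be integers with $n<2k$, let $m=\frac{n-2k}{n+2k}<0$, and let $\theta,\rho\in\mathbb{R}$ with $\theta>0$ and $2\theta+\rho>0$. Consider the equation $$\sigma_k^{1/k}\left(D^{2}\big(u^{-\frac{2k}{n+2k}}\big)-\frac{u^{\frac{2k}{n+2k}}}{2}\big|D\big(u^{-\frac{2k}{n+2k}}\big)\big|^{2}I\right)=u^{\frac{2k}{n+2k}-1}\left[(2\theta+\rho)u+\frac{4k\theta}{n+2k}\,x\cdot Du\right]\quad\text{on }\mathbb{R}^n.$$ (i) If $\rho<2\theta$, the equation does not have an admissible (positive, smooth, radially symmetric) solution. (ii) If $\rho\ge2\theta$, there exists a one-parameter family $(u_\alpha)_{\alpha>0}$, $u_\alpha(0)=\alpha$, of positive smooth radially symmetric admissible solutions of the equation on $\mathbb{R}^n$, and their decay rate is given by $u_\alpha(x)=O\big(|x|^{-\frac{4}{1-m}}\big)$ as $|x|\to\infty$.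
   Context: All derivatives and norms are Euclidean. For a symmetric matrix with eigenvalues $\lambda_1,\dots,\lambda_n$, $\sigma_k=\sum_{i_1<\dots<i_k}\lambda_{i_1}\cdots\lambda_{i_k}$. For $u>0$ put $g_u=u^{\frac{4k}{n+2k}}|dx|^2$; $A_g=\frac{1}{n-2}\left(\mathrm{Ric}_g-\frac{R_g}{2(n-1)}g\right)$ is the Schouten tensor and $\sigma_j(g):=\sigma_j(g^{-1}A_g)$. A solution $u$ is admissible if $\sigma_1(g_u),\dots,\sigma_k(g_u)>0$ everywhere. *)

(* Defs.v *)
From HB Require Import structures.
From mathcomp Require Import all_boot all_order all_algebra.
From mathcomp Require Import all_classical all_reals all_analysis.

Set Implicit Arguments.
Unset Strict Implicit.
Unset Printing Implicit Defensive.

Import Order.TTheory GRing.Theory Num.Theory.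
Import numFieldNormedType.Exports.

Local Open Scope classical_set_scope.
Local Open Scope ring_scope.

(** R^n is ['rV[R]_n].  The norm [`|x|] that the library puts on it is the sup
    norm; it is used only through the topology it induces.  Lengths are
    measured with [enorm] below. *)

Definition dotp (R : realType) (n : nat) (x y : 'rV[R]_n) : R :=
  \sum_i x 0 i * y 0 i.

Definition enorm (R : realType) (n : nat) (x : 'rV[R]_n) : R :=
  Num.sqrt (dotp x x).

Definition partial (R : realType) (n : nat) (i : 'I_n) (f : 'rV[R]_n -> R)
    (x : 'rV[R]_n) : R :=
  'D_(delta_mx 0 i) f x.

Definition grad (R : realType) (n : nat) (f : 'rV[R]_n -> R) (x : 'rV[R]_n) :
    'rV[R]_n :=
  \row_i partial i f x.

Definition hessian (R : realType) (n : nat) (f : 'rV[R]_n -> R)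
    (x : 'rV[R]_n) : 'M[R]_n :=
  \matrix_(i, j) partial i (partial j f) x.

(** [iter_partial [:: i1; ...; ir] f] is d_{i1} ... d_{ir} f. *)
Definition iter_partial (R : realType) (n : nat) (s : seq 'I_n)
    (f : 'rV[R]_n -> R) : 'rV[R]_n -> R :=
  foldr (@partial R n) f s.

(** C^infinity: partial derivatives of every order exist and are continuous.
    The derivability clause is needed because ['D_v f x] is total. *)
Definition smooth (R : realType) (n : nat) (f : 'rV[R]_n -> R) : Prop :=
  forall s : seq 'I_n,
    continuous (iter_partial s f) /\
    forall (i : 'I_n) (x : 'rV[R]_n),
      derivable (iter_partial s f) x (delta_mx 0 i).

Definition radially_symmetric (R : realType) (n : nat) (f : 'rV[R]_n -> R) :
    Prop :=
  forall x y : 'rV[R]_n, enorm x = enorm y -> f x = f y.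

(** The eigenvalues of [A], listed with algebraic multiplicity.  The list is
    unique up to order, so [sigma] does not depend on the choice made by [xget].
    It exists whenever the characteristic polynomial splits over [R], hence for
    symmetric matrices; otherwise [eigenvalues A] is the junk value 0. *)
Definition eigenvalues (R : realType) (n : nat) (A : 'M[R]_n) : 'rV[R]_n :=
  xget 0 [set l : 'rV[R]_n | char_poly A = \prod_i ('X - (l 0 i)%:P)].

Definition esymf (R : realType) (n k : nat) (l : 'rV[R]_n) : R :=
  \sum_(I : {set 'I_n} | #|I| == k) \prod_(i in I) l 0 i.

Definition sigma (R : realType) (n k : nat) (A : 'M[R]_n) : R :=
  esymf k (eigenvalues A).

(** A Riemannian metric on R^n is given by its matrix field in the standard
    global coordinates; [invmx (g x)] is the matrix (g^{ij}). *)
(** Gamma^k_{ij} of the Levi-Civita connection. *)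
Definition christoffel (R : realType) (n : nat) (g : 'rV[R]_n -> 'M[R]_n)
    (k i j : 'I_n) (x : 'rV[R]_n) : R :=
  2^-1 * \sum_l invmx (g x) k l *
    (partial i (fun y => g y j l) x + partial j (fun y => g y i l) x
     - partial l (fun y => g y i j) x).

(** Sign convention: positive on round spheres. *)
Definition ricci (R : realType) (n : nat) (g : 'rV[R]_n -> 'M[R]_n)
    (x : 'rV[R]_n) : 'M[R]_n :=
  \matrix_(i, j)
    (\sum_k (partial k (christoffel g k i j) x - partial j (christoffel g k i k) x)
     + \sum_k \sum_l (christoffel g k k l x * christoffel g l i j x
                      - christoffel g k j l x * christoffel g l i k x)).

Definition scalar_curvature (R : realType) (n : nat) (g : 'rV[R]_n -> 'M[R]_n)
    (x : 'rV[R]_n) : R :=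
  \tr (invmx (g x) *m ricci g x).

Definition schouten (R : realType) (n : nat) (g : 'rV[R]_n -> 'M[R]_n)
    (x : 'rV[R]_n) : 'M[R]_n :=
  (n%:R - 2)^-1 *:
    (ricci g x - (scalar_curvature g x / (2 * (n%:R - 1))) *: g x).

Definition sigma_metric (R : realType) (n : nat) (g : 'rV[R]_n -> 'M[R]_n)
    (j : nat) (x : 'rV[R]_n) : R :=
  sigma j (invmx (g x) *m schouten g x).

Definition conf_metric (R : realType) (n k : nat) (u : 'rV[R]_n -> R)
    (x : 'rV[R]_n) : 'M[R]_n :=
  (u x `^ (4 * k%:R / (n%:R + 2 * k%:R)))%:M.

Definition admissible (R : realType) (n k : nat) (u : 'rV[R]_n -> R) : Prop :=
  forall j : nat, (1 <= j <= k)%N ->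
  forall x : 'rV[R]_n, 0 < sigma_metric (conf_metric k u) j x.

(** [a `^ p] is the real power, which has its usual meaning for [0 < a].  For
    positive smooth admissible [u] the argument of the power 1/k is positive,
    being u^{qk} times sigma_k(g_u). *)
Definition solves (R : realType) (n k : nat) (theta rho : R)
    (u : 'rV[R]_n -> R) : Prop :=
  let q : R := 2 * k%:R / (n%:R + 2 * k%:R) in
  let v : 'rV[R]_n -> R := fun x => u x `^ (- q) in
  forall x : 'rV[R]_n,
    (sigma k (hessian v x - (u x `^ q / 2 * enorm (grad v x) ^+ 2)%:M))
      `^ (k%:R^-1)
    = u x `^ (q - 1)
      * ((2 * theta + rho) * u x
         + 4 * k%:R * theta / (n%:R + 2 * k%:R) * dotp x (grad u x)).

Definition admissible_solution (R : realType) (n k : nat) (theta rho : R)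
    (u : 'rV[R]_n -> R) : Prop :=
  [/\ forall x, 0 < u x, smooth u, radially_symmetric u,
      solves k theta rho u & admissible k u].

(** f(x) = O(|x|^a) as |x| -> infinity. *)
Definition bigO_pow_at_infty (R : realType) (n : nat) (f : 'rV[R]_n -> R)
    (a : R) : Prop :=
  exists C M : R, 0 < M /\
    forall x : 'rV[R]_n, M <= enorm x -> `|f x| <= C * enorm x `^ a.

(* Main.v *)
Require Import Defs.
From HB Require Import structures.
From mathcomp Require Import all_boot all_order all_algebra.
From mathcomp Require Import all_classical all_reals all_analysis.
From mathcomp Require Import ring lra.
Set Implicit Arguments.
Unset Strict Implicit.
Unset Printing Implicit Defensive.
Import Order.TTheory GRing.Theory Num.Theory.
Import numFieldNormedType.Exports.
Local Open Scope classical_set_scope.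
Local Open Scope ring_scope.

(** Put [v = u^(-q)], [s = |x|^2] and [y = 2 s v_s / v].  For a radial [v] the
    matrix in the equation has eigenvalues [b] (n - 1 times) and [e], where
    [b = (v / s) y (1 - y / 2)], and [v] times it is the Schouten endomorphism of
    [g_u]; the right-hand side is [(2 theta / v) (kap - y)] with
    [kap = 1 + rho / (2 theta)].

    (i) Positivity of sigma_1 and sigma_2 gives [b > 0], i.e. [0 < y < 2], and
    positivity of sigma_k gives [s y_s > (1 - n/2k) y (1 - y/2)].  The right-hand
    side forces [y < kap < 2], so [y] grows at least like a multiple of [ln s],
    which is absurd.

    (ii) Use [t], with [y = 2t/(1+t)], as independent variable.  The sphere is
    [v = v0 (1 + t)], and the deviation from it is governed by one scalar function
    [Lam] with [e^(-Lam) = 1] on the sphere.  After the substitution [Phi] below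
    the equation for [Lam] is linear up to a globally Lipschitz term, with a
    regular singular point at [t = 0], hence globally solvable by Picard
    iteration; [v] and [s] are then explicit in [t], [Lam] and a primitive.  The
    bound [v >= c s] gives the decay of [u]. *)

(** * One-sided smooth functions on the half-line *)

(** The unknown [Lam] is defined by (n - k) b + k e = n b e^(-Lam), so that sigma_k = C(n,k) b^k
    e^(-Lam). Once [b > 0], every value [Lam >= 0] gives sigma_1, ..., sigma_k > 0; admissibility is
    therefore built into the unknowns and needs no continuation argument. In terms of t, kap - y =
    (kap + (kap - 2) t) / (1 + t). For kap >= 2 this is positive on the whole half-line, and for kap
    < 2 it changes sign: this is the threshold rho = 2 theta. Define psi by ds/s = (1 + psi) dt/t.
    Differentiating V twice gives psi as a function of Lam, namely (1 + psi) gam (1 - e^(-Lam)) =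
    psi with gam = n/2k. The equation for Lam is the compatibility of this relation with the k-th
    root of the equation, which is algebraic in V, V_s, t and Lam. The hypothesis n < 2k is gam < 1;
    it bounds psi by gam / (1 - gam), and this bound makes V grow linearly in s. The remaining
    obstacle is the origin: s = 0 is a boundary point of the half-line on which the profile lives,
    and explicit derivatives divide by t or s there. *)

(* [is_derive] is a type class; this synonym keeps instance search, which would
   pick a derivative of its own, out of [apply]. *)
Definition has_derive (R : realType) (V : normedModType R) (x v : V)
  (f : V -> R) (d : R) : Prop := is_derive x v f d.

Section Derive.
Context {R : realType} {V : normedModType R}.
Implicit Types (f g : V -> R) (x v : V).

Lemma has_derive_eq f x v a b : has_derive x v f a -> a = b -> has_derive x v f b.
Proof. by move=> ? <-. Qed.

Lemma has_derive_const (c : R) x v : has_derive x v (fun=> c) 0.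
Proof. exact: is_derive_cst. Qed.

Lemma has_derive_add f g x v a b : has_derive x v f a -> has_derive x v g b ->
  has_derive x v (fun y => f y + g y) (a + b).
Proof. by move=> fa gb; exact: (is_deriveD fa gb). Qed.

Lemma has_derive_opp f x v a : has_derive x v f a ->
  has_derive x v (fun y => - f y) (- a).
Proof. by move=> fa; exact: (is_deriveN fa). Qed.

Lemma has_derive_sub f g x v a b : has_derive x v f a -> has_derive x v g b ->
  has_derive x v (fun y => f y - g y) (a - b).
Proof. by move=> fa gb; exact: (is_deriveB fa gb). Qed.

Lemma has_derive_mul f g x v a b : has_derive x v f a -> has_derive x v g b ->
  has_derive x v (fun y => f y * g y) (a * g x + f x * b).
Proof.
move=> fa gb; apply: (is_derive_eq (is_deriveM fa gb)).
by rewrite /GRing.scale /= addrC (mulrC a).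
Qed.

Lemma has_derive_exp f n x v a : has_derive x v f a ->
  has_derive x v (fun y => f y ^+ n) (n%:R * f x ^+ n.-1 * a).
Proof.
move=> fa; elim: n => [|n IH].
  apply: has_derive_eq (has_derive_const 1 x v) _.
  by rewrite mulr0n !mul0r.
rewrite (_ : (fun y => _) = (fun y => f y * f y ^+ n)); last first.
  by apply/funext => y; rewrite exprS.
apply: has_derive_eq (has_derive_mul fa IH) _.
case: n {IH} => [|n]; first by rewrite mulr0n !mul0r mulr0 addr0 /= expr0 !mulr1 mul1r.
by rewrite /= (exprS (f x) n) -[n.+2%:R]natr1; ring.
Qed.

Lemma has_derive_inv f x v a : f x != 0 -> has_derive x v f a ->
  has_derive x v (fun y => (f y)^-1) (- a / f x ^+ 2).
Proof.
move=> f0 [d e]; split; first exact: derivableV.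
by rewrite deriveV // e /GRing.scale /= mulrC mulrN mulNr.
Qed.

Lemma has_derive_line f x v a :
  has_derive x v f a <-> has_derive (0 : R) 1 (fun h : R => f (h *: v + x)) a.
Proof.
have E : 'D_v f x = 'D_1 (fun h : R => f (h *: v + x)) (0 : R).
  rewrite /derive; set g1 := fun h => h^-1 *: _; set g2 := fun h => h^-1 *: _.
  suff -> : g1 = g2 by [].
  by apply/funext => h; rewrite /g1 /g2 /= addr0 scale0r add0r [_%:A]mulr1.
split=> -[d e]; split.
- exact/(@derivable1P R V R f x v).
- by rewrite -E.
- exact/(@derivable1P R V R f x v).
- by rewrite E.
Qed.

(** Restriction to the line through [x] makes the chain rule one-dimensional, so [g] need only be
    derivable in the direction [v], not differentiable. *)
Lemma has_derive_comp_line (F : R -> R) g x v a b :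
  has_derive (g x) 1 F a -> has_derive x v g b ->
  has_derive x v (fun y => F (g y)) (a * b).
Proof.
move=> Fa /has_derive_line gb; apply/has_derive_line.
have Fa' : has_derive (g (0 *: v + x)) 1 F a by rewrite scale0r add0r.
exact: (@is_derive1_comp _ F (fun h : R => g (h *: v + x)) 0 a b Fa' gb).
Qed.

Lemma has_derive_unique f x v a b :
  has_derive x v f a -> has_derive x v f b -> a = b.
Proof. by move=> [_ <-] [_ <-]. Qed.

End Derive.

Section Comp1.
Context {R : realType}.
Implicit Types f g : R -> R.

Lemma has_derive_var (x : R) : has_derive x 1 (fun y : R => y) 1.
Proof. exact: is_derive_id. Qed.

Lemma has_derive_linear (c x : R) : has_derive x 1 (fun y : R => c * y) c.
Proof.
have H := has_derive_mul (has_derive_const c x 1) (has_derive_var x).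
apply: (has_derive_eq H).
by rewrite mul0r add0r mulr1.
Qed.

Lemma has_derive_comp f g (x a b : R) :
  has_derive (g x) 1 f a -> has_derive x 1 g b ->
  has_derive x 1 (fun y => f (g y)) (a * b).
Proof. by move=> fa gb; exact: (is_derive1_comp fa gb). Qed.

Lemma has_derive_expR_comp g (x b : R) : has_derive x 1 g b ->
  has_derive x 1 (fun y => expR (g y)) (expR (g x) * b).
Proof. by move=> gb; apply: (has_derive_comp _ gb); exact: is_derive_expR. Qed.

Lemma has_derive_powR (p x : R) : 0 < x ->
  has_derive x 1 (fun t : R => t `^ p) (p * x `^ (p - 1)).
Proof. by move=> x0; exact: is_derive1_powR. Qed.

Lemma has_derive_continuous f (x a : R) : has_derive x 1 f a ->
  {for x, continuous f}.
Proof. by move=> [df _]; exact/differentiable_continuous/derivable1_diffP. Qed.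

Lemma near_gt0 (x : R) : 0 < x -> \forall y \near x, 0 < y.
Proof. by move=> x0; exact: lt_nbhsr. Qed.

Lemma has_derive_eq_gt0 f g (x a : R) : 0 < x ->
  (forall y, 0 < y -> f y = g y) -> has_derive x 1 f a -> has_derive x 1 g a.
Proof.
move=> x0 fg; apply: near_eq_is_derive.
by near=> y; apply: fg; near: y; exact: near_gt0.
Unshelve. all: by end_near. Qed.

Lemma continuous_compose (T U W : topologicalType) (f : U -> W) (g : T -> U) (x : T) :
  {for x, continuous g} -> {for g x, continuous f} ->
  {for x, continuous (fun y => f (g y))}.
Proof. exact: continuous_comp. Qed.

(* One-sided regularity on [0, +oo[: precomposing with the absolute value turns
   continuity on [0, +oo[ into plain continuity, whatever the values at x < 0. *)
Definition cont_ge0 f := continuous (fun x : R => f `|x|).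

Definition deriv_gt0 f f' := forall x : R, 0 < x -> has_derive x 1 f (f' x).

(** No derivative is taken at 0, but each derivative has to extend continuously to 0. By the mean
    value theorem this is one-sided C^j regularity on the closed half-line, with a derivative whose
    value at 0 is the limit. *)
Fixpoint Ck (j : nat) f : Prop :=
  cont_ge0 f /\ if j is j'.+1 then exists2 f', deriv_gt0 f f' & Ck j' f' else True.

Lemma Ck_cont j f : Ck j f -> cont_ge0 f.
Proof. by case: j => [|j] []. Qed.

Lemma CkW j f : Ck j.+1 f -> Ck j f.
Proof.
elim: j f => [|j IH] f [cf [f' df Cf']]; first by split.
by split=> //; exists f' => //; exact: IH.
Qed.

Lemma cont_ge0_eq f g : (forall x, 0 <= x -> f x = g x) -> cont_ge0 f -> cont_ge0 g.
Proof.
move=> fg; rewrite /cont_ge0 (_ : (fun x => f `|x|) = (fun x => g `|x|)) //.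
by apply/funext => x; rewrite fg.
Qed.

Lemma Ck_eq j f g : (forall x, 0 <= x -> f x = g x) -> Ck j f -> Ck j g.
Proof.
move=> fg; case: j => [|j] [cf H]; split=> //; try exact: cont_ge0_eq cf.
case: H => f' df Cf'; exists f' => // x x0.
by apply: has_derive_eq_gt0 (df x x0) => // y /ltW; exact: fg.
Qed.

Lemma cont_ge0_comp f g : (forall x, 0 <= x -> 0 <= g x) ->
  cont_ge0 f -> cont_ge0 g -> cont_ge0 (fun x => f (g x)).
Proof.
move=> g0 cf cg.
move=> x; have /= H := continuous_compose (cg x) (cf (g `|x|)).
rewrite (_ : (fun x => f (g `|x|)) = (fun x => f `|g `|x| |)) //.
by apply/funext => y; rewrite (ger0_norm (g0 _ _)).
Qed.

Lemma cont_ge0_outer f g : (forall x, 0 <= x -> {for g x, continuous f}) ->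
  cont_ge0 g -> cont_ge0 (fun x => f (g x)).
Proof. by move=> cf cg x; exact: (continuous_compose (cg x) (cf _ _)). Qed.

Lemma Ck_cst j (c : R) : Ck j (fun=> c).
Proof.
elim: j c => [|j IH] c; split=> //; try exact: cst_continuous.
by exists (fun=> 0) => // x _; exact: has_derive_const.
Qed.

Lemma Ck_id j : Ck j id.
Proof.
case: j => [|j]; split=> //; try exact: norm_continuous.
by exists (fun=> 1); [move=> x _; exact: has_derive_var|exact: Ck_cst].
Qed.

Lemma Ck_add j f g : Ck j f -> Ck j g -> Ck j (fun x => f x + g x).
Proof.
elim: j f g => [|j IH] f g [cf Hf] [cg Hg]; split=> //;
  try (by move=> x; apply: continuousD; [exact: cf|exact: cg]).
case: Hf Hg => f' df Cf [g' dg Cg].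
exists (fun x => f' x + g' x); last exact: IH.
by move=> x x0; apply: has_derive_add; [exact: df|exact: dg].
Qed.

Lemma Ck_mul j f g : Ck j f -> Ck j g -> Ck j (fun x => f x * g x).
Proof.
elim: j f g => [|j IH] f g Cf Cg; (split; first
  (by move=> x; apply: continuousM; [exact: (Ck_cont Cf)|exact: (Ck_cont Cg)])) => //.
have [Cf1 Cg1] := (CkW Cf, CkW Cg).
case: Cf Cg => _ [f' df Cf] [_ [g' dg Cg]].
exists (fun x => f' x * g x + f x * g' x).
  by move=> x x0; apply: has_derive_mul; [exact: df|exact: dg].
by apply: Ck_add; exact: IH.
Qed.

Lemma cont_ge0_mul f g : cont_ge0 f -> cont_ge0 g -> cont_ge0 (fun x => f x * g x).
Proof. by move=> cf cg; apply: (@Ck_cont 0); apply: Ck_mul. Qed.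

Lemma Ck_opp j f : Ck j f -> Ck j (fun x => - f x).
Proof.
move=> Cf; apply: (@Ck_eq _ (fun x => -1 * f x)).
  by move=> x _; rewrite mulN1r.
by apply: Ck_mul => //; exact: Ck_cst.
Qed.

Lemma Ck_sub j f g : Ck j f -> Ck j g -> Ck j (fun x => f x - g x).
Proof. by move=> Cf Cg; apply: Ck_add => //; exact: Ck_opp. Qed.

Lemma Ck_exp j f n : Ck j f -> Ck j (fun x => f x ^+ n).
Proof.
move=> Cf; elim: n => [|n IH].
  by apply: (@Ck_eq _ (fun=> 1)); [move=> x _; rewrite expr0|exact: Ck_cst].
apply: (@Ck_eq _ (fun x => f x * f x ^+ n)); first by move=> x _; rewrite exprS.
exact: Ck_mul.
Qed.

Lemma Ck_inv j f : (forall x, 0 <= x -> f x != 0) -> Ck j f ->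
  Ck j (fun x => (f x)^-1).
Proof.
move=> f0; elim: j => [|j IH] Cf; (split; first
  (by move=> x; apply: (@continuousV _ _ (fun x => f `|x|)); [exact: f0|exact: (Ck_cont Cf)])) => //.
have IH' := IH (CkW Cf).
case: Cf => _ [f' df Cf].
exists (fun x => - f' x * (f x)^-1 ^+ 2).
  move=> x x0; apply: has_derive_eq; last by rewrite exprVn.
  by apply: has_derive_inv; [exact/f0/ltW|exact: df].
by apply: Ck_mul; [exact: Ck_opp|exact: Ck_exp].
Qed.

Lemma Ck_div j f g : (forall x, 0 <= x -> g x != 0) -> Ck j f -> Ck j g ->
  Ck j (fun x => f x / g x).
Proof. by move=> g0 Cf Cg; apply: Ck_mul => //; exact: Ck_inv. Qed.

Lemma Ck_comp j f g : (forall x, 0 <= x -> 0 <= g x) -> (forall x, 0 < x -> 0 < g x) ->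
  Ck j f -> Ck j g -> Ck j (fun x => f (g x)).
Proof.
move=> g0 gp; elim: j f => [|j IH] f Cf Cg; (split; first
  exact: (cont_ge0_comp g0 (Ck_cont Cf) (Ck_cont Cg))) => //.
have IH' := fun f Cf => IH f Cf (CkW Cg).
case: Cf Cg => _ [f' df Cf] [_ [g' dg Cg]].
exists (fun x => f' (g x) * g' x).
  by move=> x x0; apply: has_derive_comp; [exact/df/gp|exact: dg].
by apply: Ck_mul => //; exact: IH'.
Qed.

Lemma Ck_expR j f : Ck j f -> Ck j (fun x => expR (f x)).
Proof.
elim: j f => [|j IH] f Cf; (split; first
  (by move=> x; apply: (@continuous_compose R R R expR (fun x => f `|x|));
   [exact: (Ck_cont Cf)|exact: continuous_expR])) => //.
have IH' := IH _ (CkW Cf).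
case: Cf => _ [f' df Cf].
exists (fun x => expR (f x) * f' x); last exact: Ck_mul.
by move=> x x0; apply: has_derive_expR_comp; exact: df.
Qed.

Lemma Ck_powR j f p : (forall x, 0 <= x -> 0 < f x) -> Ck j f ->
  Ck j (fun x => f x `^ p).
Proof.
move=> f0; elim: j p => [|j IH] p Cf; (split; first
  (apply: (cont_ge0_outer (f := fun t : R => t `^ p)) (Ck_cont Cf) => x x0;
   exact: (has_derive_continuous (has_derive_powR p (f0 x x0))))) => //.
have IH' := IH _ (CkW Cf).
case: Cf => _ [f' df Cf].
exists (fun x => p * f x `^ (p - 1) * f' x).
  move=> x x0; apply: (@has_derive_comp (fun t : R => t `^ p)); last exact: df.
  by apply: has_derive_powR; exact/f0/ltW.
by apply: Ck_mul => //; apply: Ck_mul => //; exact: Ck_cst.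
Qed.

Lemma within_cont_ge0 f (a b : R) : 0 <= a -> cont_ge0 f ->
  {within `[a, b], continuous f}.
Proof.
move=> a0 cf.
apply: (@subspace_eq_continuous _ _ _ (fun x => f `|x|)).
  move=> x; rewrite inE /= in_itv /= => /andP[ax _] /=.
  by rewrite ger0_norm // (le_trans a0).
exact: continuous_subspaceT.
Qed.

Lemma deriv_ge0_nondecreasing f f' (x y : R) : cont_ge0 f -> deriv_gt0 f f' ->
  0 <= x -> x <= y -> (forall z, x < z < y -> 0 <= f' z) -> f x <= f y.
Proof.
move=> cf df x0 xy f'0.
have H z : z \in `]x, y[ -> 0 < z.
  by rewrite in_itv /= => /andP[xz _]; exact: le_lt_trans xz.
apply: (@ger0_derive1_le_cc _ f x y) => //.
- by move=> z /H z0; case: (df z z0).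
- move=> z zxy; have := H z zxy => z0; rewrite derive1E; case: (df z z0) => _ ->.
  by apply: f'0; move: zxy; rewrite in_itv.
- exact: within_cont_ge0.
- by rewrite in_itv /= lexx xy.
- by rewrite in_itv /= lexx xy.
Qed.

Lemma deriv_le_le f g f' g' (x : R) : cont_ge0 f -> cont_ge0 g ->
  deriv_gt0 f f' -> deriv_gt0 g g' -> f 0 <= g 0 ->
  0 <= x -> (forall z, 0 < z < x -> f' z <= g' z) -> f x <= g x.
Proof.
move=> cf cg df dg fg0 x0 fg'.
have : g 0 - f 0 <= g x - f x.
  apply: (@deriv_ge0_nondecreasing (fun x => g x - f x) (fun x => g' x - f' x)) => //.
  - by move=> y; apply: continuousB; [exact: cg|exact: cf].
  - by move=> y y0; apply: has_derive_sub; [exact: dg|exact: df].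
  - by move=> y y0; rewrite subr_ge0 fg'.
lra.
Qed.

Lemma deriv_eq f g f' (x : R) : cont_ge0 f -> cont_ge0 g ->
  deriv_gt0 f f' -> deriv_gt0 g f' -> f 0 = g 0 -> 0 <= x -> f x = g x.
Proof.
move=> cf cg df dg fg0 x0; apply/eqP; rewrite eq_le.
by apply/andP; split; apply: (deriv_le_le (f' := f') (g' := f')) => //; rewrite fg0.
Qed.

(** Takes the place of integral estimates: a bound on a primitive is obtained by exhibiting an
    explicit majorant and comparing derivatives. *)
Lemma deriv_norm_le f g f' g' (x : R) : cont_ge0 f -> cont_ge0 g ->
  deriv_gt0 f f' -> deriv_gt0 g g' -> f 0 = 0 -> 0 <= g 0 -> 0 <= x ->
  (forall z, 0 < z < x -> `|f' z| <= g' z) -> `|f x| <= g x.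
Proof.
move=> cf cg df dg f00 g00 x0 fg'; rewrite ler_norml; apply/andP; split.
  rewrite lerNl; apply: (@deriv_le_le (fun x => - f x) g (fun x => - f' x) g') => //.
  - by move=> y; apply: continuousN; exact: cf.
  - by move=> y y0; apply: has_derive_opp; exact: df.
  - by rewrite f00 oppr0.
  - by move=> y y0; rewrite (le_trans _ (fg' y y0)) // -normrN ler_norm.
apply: (@deriv_le_le f g f' g') => //; first by rewrite f00.
by move=> y y0; rewrite (le_trans _ (fg' y y0)) // ler_norm.
Qed.

(** Integration starts at -1 and the piece up to 0 is subtracted, so that 0 is an interior point of
    the interval. The fundamental theorem then applies at 0 as well and yields continuity there. *)
Definition primitive (c : R -> R) (x : R) : R :=
  \int[lebesgue_measure]_(t in `[-1, x]) c `|t| -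
  \int[lebesgue_measure]_(t in `[-1, 0]) c `|t|.

Lemma primitive0 c : primitive c 0 = 0.
Proof. by rewrite /primitive subrr. Qed.

Lemma has_derive_primitive c (x : R) : cont_ge0 c -> -1 < x ->
  has_derive x 1 (primitive c) (c `|x|).
Proof.
move=> cc x0; have xx1 : x < x + 1 by rewrite ltrDl.
have ic : lebesgue_measure.-integrable `[-1, (x + 1)] (EFin \o (fun t : R => c `|t|)).
  apply: continuous_compact_integrable; first exact: segment_compact.
  exact: continuous_subspaceT.
have [d e] := continuous_FTC1_closed xx1 ic x0 (cc x).
have D : has_derive x 1 (fun y => \int[lebesgue_measure]_(t in `[-1, y]) c `|t|) (c `|x|).
  by split; [exact: d|rewrite -derive1E; exact: e].
have := has_derive_sub D
  (has_derive_const (\int[lebesgue_measure]_(t in `[-1, 0]) c `|t|) x 1).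
by rewrite subr0.
Qed.

Lemma primitive_deriv c : cont_ge0 c -> deriv_gt0 (primitive c) c.
Proof.
move=> cc x x0; rewrite -{2}(ger0_norm (ltW x0)).
by apply: has_derive_primitive => //; apply: lt_trans x0; rewrite ltrN10.
Qed.

Lemma primitive_cont c : cont_ge0 c -> cont_ge0 (primitive c).
Proof.
move=> cc x; apply: (@continuous_compose R R R (primitive c) Num.norm).
  exact: norm_continuous.
apply: has_derive_continuous; apply: has_derive_primitive => //.
by apply: lt_le_trans (normr_ge0 x); rewrite ltrN10.
Qed.

Lemma Ck_primitive j c : Ck j c -> Ck j.+1 (primitive c).
Proof.
move=> Cc; have cc := Ck_cont Cc; split; first exact: primitive_cont.
by exists c => //; exact: primitive_deriv.
Qed.

End Comp1.

(** * Inverses of increasing one-sided smooth functions on the half-line *)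

Section Inverse.
Context {R : realType}.
Implicit Types f g : R -> R.

Lemma deriv_gt0_increasing f f' : cont_ge0 f -> deriv_gt0 f f' ->
  (forall x, 0 < x -> 0 < f' x) -> forall x y, 0 <= x -> x < y -> f x < f y.
Proof.
move=> cf df f'0 x y x0 xy.
have H z : z \in `]x, y[ -> 0 < z.
  by rewrite in_itv /= => /andP[xz _]; exact: le_lt_trans xz.
apply: (@gtr0_derive1_lt_cc _ f x y) => //.
- by move=> z /H z0; case: (df z z0).
- by move=> z /H z0; rewrite derive1E; case: (df z z0) => _ ->; exact: f'0.
- exact: within_cont_ge0.
- by rewrite in_itv /= lexx ltW.
- by rewrite in_itv /= lexx ltW.
Qed.

Definition inverse_ge0 f (y : R) : R := xget 0 [set x | 0 <= x /\ f x = y].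

Section InverseFunction.
Variables f f' : R -> R.
Hypotheses (cf : cont_ge0 f) (df : deriv_gt0 f f').
Hypotheses (f'0 : forall x, 0 <= x -> 0 < f' x) (f0 : f 0 = 0).
Hypothesis funbounded : forall y, exists2 x, 0 <= x & y <= f x.

Let incr : forall x y, 0 <= x -> x < y -> f x < f y.
Proof. by apply: deriv_gt0_increasing cf df _ => x /ltW; exact: f'0. Qed.

Lemma inverse_ge0_spec y : 0 <= y -> 0 <= inverse_ge0 f y /\ f (inverse_ge0 f y) = y.
Proof.
move=> y0; have [b b0 yb] := funbounded y.
have [|c] := IVT b0 (within_cont_ge0 (lexx 0) cf) (v := y).
  by rewrite f0 ge_min y0 le_max yb orbT.
rewrite in_itv /= => /andP[c0 _] fc.
by apply: (@xgetPex R 0 [set x | 0 <= x /\ f x = y]); exists c.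
Qed.

Lemma inverse_ge0K x : 0 <= x -> inverse_ge0 f (f x) = x.
Proof.
move=> x0; have fx0 : 0 <= f x.
  by move: x0; rewrite le_eqVlt => /predU1P[<-|/(incr (lexx 0))/ltW]; rewrite f0.
have [g0 fg] := inverse_ge0_spec fx0.
case: (ltgtP (inverse_ge0 f (f x)) x) => // h.
  by have := incr g0 h; rewrite fg ltxx.
by have := incr x0 h; rewrite fg ltxx.
Qed.

Lemma inverse_ge00 : inverse_ge0 f 0 = 0.
Proof. by have := inverse_ge0K (lexx 0); rewrite f0. Qed.

Lemma inverse_ge0_gt0 y : 0 < y -> 0 < inverse_ge0 f y.
Proof.
move=> y0; have [g0 fg] := inverse_ge0_spec (ltW y0).
rewrite lt_neqAle g0 andbT; apply/eqP => e.
by move: y0; rewrite -fg -e f0 ltxx.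
Qed.

Lemma inverse_ge0_lt x y : 0 <= x -> 0 <= y -> y < f x -> inverse_ge0 f y < x.
Proof.
move=> x0 y0 yx; have [g0 fg] := inverse_ge0_spec y0.
rewrite ltNge; apply/negP; rewrite le_eqVlt => /predU1P[e|/(incr x0)].
  by move: yx; rewrite e fg ltxx.
by rewrite fg => /lt_trans/(_ yx); rewrite ltxx.
Qed.

Lemma inverse_ge0_deriv : deriv_gt0 (inverse_ge0 f) (fun y => (f' (inverse_ge0 f y))^-1).
Proof.
move=> y y0; have [_ fg] := inverse_ge0_spec (ltW y0).
have gp := inverse_ge0_gt0 y0.
rewrite -{1}fg; apply: (@is_derive_inverse R f).
- by near=> x; apply: inverse_ge0K; apply: ltW; near: x; exact: near_gt0.
- near=> x; have x0 : 0 < x by near: x; exact: near_gt0.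
  exact: has_derive_continuous (df x0).
- exact: df.
- by rewrite gt_eqF // f'0 // ltW.
Unshelve. all: by end_near. Qed.

Lemma inverse_ge0_cont : cont_ge0 (inverse_ge0 f).
Proof.
move=> y; have [->|y0] := eqVneq y 0.
  (* The derivative formula is available only away from 0. At 0 monotonicity suffices: [f e] is a
     modulus of continuity for [e]. *)
  apply/cvgrPdist_lt => e e0; rewrite normr0 inverse_ge00.
  have fe0 : 0 < f e by rewrite -f0 incr.
  exists (f e) => //= z; rewrite /= !sub0r !normrN => ze.
  have [gz0 _] := inverse_ge0_spec (normr_ge0 z).
  by rewrite ger0_norm //; apply: inverse_ge0_lt => //; exact: ltW.
apply: (continuous_compose (f := inverse_ge0 f) (g := Num.norm)).
  exact: norm_continuous.
by apply: has_derive_continuous; apply: inverse_ge0_deriv; rewrite normr_gt0.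
Qed.

(** Bootstrap: the derivative of the inverse is 1/f' composed with the inverse, hence as regular as
    the inverse is already known to be. *)
Lemma inverse_ge0_Ck j : (forall i, Ck i f') -> Ck j (inverse_ge0 f).
Proof.
move=> Cf'; elim: j => [|j IH]; (split; first exact: inverse_ge0_cont) => //.
exists (fun y => (f' (inverse_ge0 f y))^-1); first exact: inverse_ge0_deriv.
have g0 y : 0 <= y -> 0 <= inverse_ge0 f y by move=> /inverse_ge0_spec[].
apply: Ck_inv; first by move=> y /g0 /f'0 h; rewrite gt_eqF.
by apply: Ck_comp => //; exact: inverse_ge0_gt0.
Qed.

End InverseFunction.
End Inverse.

(** * Linear equations with a regular singular point, and Picard iteration *)

Section Singular.
Context {R : realType}.
Implicit Types f g : R -> R.

Lemma cont_ge0_powR (a : R) : 0 < a -> cont_ge0 (fun t : R => t `^ a).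
Proof.
move=> a0 y; have [->|y0] := eqVneq y 0.
  apply/cvgrPdist_lt => e e0; exists (e `^ a^-1) => /= [|z /=]; first exact: powR_gt0.
  rewrite sub0r normrN normr0 powR0 ?gt_eqF // sub0r normrN => ze.
  rewrite ger0_norm ?powR_ge0 //.
  have -> : e = (e `^ a^-1) `^ a by rewrite -powRrM mulVf ?gt_eqF // powRr1 // ltW.
  by apply: gt0_ltr_powR => //; rewrite nnegrE ?powR_ge0.
apply: (continuous_compose (f := fun t : R => t `^ a) (g := Num.norm)).
  exact: norm_continuous.
by apply: has_derive_continuous; apply: has_derive_powR; rewrite normr_gt0.
Qed.

Lemma powR_deriv (a : R) : deriv_gt0 (fun t : R => t `^ a) (fun t => a * t `^ (a - 1)).
Proof. by move=> x x0; exact: has_derive_powR. Qed.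

Lemma powRD1 (t a : R) : 0 < t -> t `^ (a + 1) = t * t `^ a.
Proof. by move=> t0; rewrite powRD ?(gt_eqF t0) ?implybT // powRr1 1?mulrC // ltW. Qed.

Definition weighted_primitive (a : R) g := primitive (fun t => t `^ a * g t).

Section Weighted.
Variables (a : R) (g : R -> R).
Hypotheses (a0 : 0 < a) (cg : cont_ge0 g).

Let cwg : cont_ge0 (fun t => t `^ a * g t).
Proof. by apply: cont_ge0_mul => //; exact: cont_ge0_powR. Qed.

Lemma weighted_primitive_cont : cont_ge0 (weighted_primitive a g).
Proof. exact: primitive_cont. Qed.

Lemma weighted_primitive_deriv :
  deriv_gt0 (weighted_primitive a g) (fun t => t `^ a * g t).
Proof. exact: primitive_deriv. Qed.

End Weighted.

(* For t > 0 this is the integral of s^a g(s t) over s in [0, 1]. *)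
Definition average (a : R) g (t : R) : R :=
  if 0 < t then weighted_primitive a g t / t `^ (a + 1) else g 0 / (a + 1).

Section Average.
Variables (a : R) (g : R -> R).
Hypotheses (a0 : 0 < a) (cg : cont_ge0 g).

Lemma averageE (t : R) : 0 <= t -> weighted_primitive a g t = t `^ (a + 1) * average a g t.
Proof.
rewrite le_eqVlt => /predU1P[<-|t0].
  by rewrite powR0 ?mul0r ?gt_eqF ?addr_gt0 // /weighted_primitive primitive0.
by rewrite /average t0 mulrC divfK // gt_eqF // powR_gt0.
Qed.

Lemma average_deriv :
  deriv_gt0 (average a g) (fun t => (g t - (a + 1) * average a g t) / t).
Proof.
move=> t t0; have tp := powR_gt0 (a + 1) t0.
apply: (@has_derive_eq_gt0 _ (fun t => weighted_primitive a g t / t `^ (a + 1))) => //.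
  by move=> y y0; rewrite /average y0.
apply: has_derive_eq.
  apply: has_derive_mul; first exact: weighted_primitive_deriv.
  by apply: has_derive_inv (powR_deriv _ t0); rewrite gt_eqF.
rewrite averageE ?ltW // addrK powRD1 //.
have := powR_gt0 a t0; move: (t `^ a) => p p0; field.
by rewrite !gt_eqF.
Qed.

Lemma average_cont : cont_ge0 (average a g).
Proof.
have a1 : 0 < a + 1 by rewrite addr_gt0.
move=> y; have [->|y0] := eqVneq y 0; last first.
  apply: (continuous_compose (f := average a g) (g := Num.norm)).
    exact: norm_continuous.
  by apply: has_derive_continuous; apply: average_deriv; rewrite normr_gt0.
apply/cvgrPdist_le => e e0.
have dP : exists d : R, 0 < d /\ forall t : R, `|t| < d -> `|g 0 - g `|t| | <= e * (a + 1).
  have /cvgrPdist_le/(_ (e * (a + 1))) := @cg 0.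
  rewrite mulr_gt0 // normr0 => /(_ isT)[d d0 dP]; exists d; split=> // t td; apply: dP.
  by rewrite /= sub0r normrN.
case: dP => d [d0 dP].
exists d => //= t; rewrite /= sub0r normrN normr0 => td.
rewrite {1}/average ltxx /average; case: ifPn => [t0|_]; last by rewrite subrr normr0 ltW.
have tp := powR_gt0 (a + 1) t0.
(* Since t^(a+1)/(a+1) is the primitive of t^a, the deviation from g 0/(a+1) is the average of g - g
   0, which is small near 0 because g is continuous there. *)
rewrite (_ : _ - _ = - ((weighted_primitive a g `|t| -
  (a + 1)^-1 * `|t| `^ (a + 1) * g 0) / `|t| `^ (a + 1))); last first.
  by field; rewrite !gt_eqF.
rewrite normrN normrM normfV (gtr0_norm tp) ler_pdivrMr //.
apply: (@deriv_norm_le R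
  (fun t => weighted_primitive a g t - (a + 1)^-1 * t `^ (a + 1) * g 0)
  (fun t => e * t `^ (a + 1)) (fun t => t `^ a * (g t - g 0))
  (fun t => e * ((a + 1) * t `^ a)) `|t|) => //.
- apply: (@Ck_cont _ 0); apply: Ck_sub; first by split=> //; exact: weighted_primitive_cont.
  by apply: Ck_mul; [apply: Ck_mul; [exact: Ck_cst|split=> //; exact: cont_ge0_powR]|exact: Ck_cst].
- apply: (@Ck_cont _ 0); apply: Ck_mul; first exact: Ck_cst.
  by split=> //; exact: cont_ge0_powR.
- move=> x x0; rewrite mulrBr; apply: has_derive_sub; first exact: weighted_primitive_deriv.
  apply: has_derive_eq.
    apply: has_derive_mul (has_derive_const _ _ _).
    by apply: has_derive_mul (has_derive_const _ _ _) (powR_deriv _ x0).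
  by rewrite mulr0 addr0 mul0r add0r addrK mulKf // gt_eqF.
- move=> x x0; apply: has_derive_eq.
    by apply: has_derive_mul (has_derive_const _ _ _) (powR_deriv _ x0).
  by rewrite mul0r add0r addrK.
- by rewrite /weighted_primitive primitive0 powR0 ?gt_eqF // mulr0 mul0r subr0.
- by rewrite powR0 ?gt_eqF // mulr0.
- move=> z /andP[z0 zt]; rewrite normrM (ger0_norm (powR_ge0 _ _)) mulrA mulrC.
  rewrite ler_wpM2r ?powR_ge0 // distrC -{1}(gtr0_norm z0).
  by apply: dP; rewrite (gtr0_norm z0) (lt_trans zt).
Qed.

End Average.

(** Differentiating the integral of s^a g(s t) over [0, 1] under the integral sign produces a factor
    s, hence the exponent a + 1. The proof obtains this through the integration by parts [E]. Unlike
    [average_deriv], the resulting formula does not divide by t and so carries regularity up to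
    0. *)
Lemma average_deriv_C1 (a : R) g g' : 0 < a -> cont_ge0 g -> cont_ge0 g' ->
  deriv_gt0 g g' -> deriv_gt0 (average a g) (average (a + 1) g').
Proof.
move=> a0 cg cg' dg t t0.
have a1 : 0 < a + 1 by rewrite addr_gt0.
apply: has_derive_eq (average_deriv a0 cg t0) _.
have E : weighted_primitive (a + 1) g' t =
         t `^ (a + 1) * g t - (a + 1) * weighted_primitive a g t.
  apply: (@deriv_eq R (weighted_primitive (a + 1) g')
    (fun t => t `^ (a + 1) * g t - (a + 1) * weighted_primitive a g t)
    (fun t => t `^ (a + 1) * g' t)); last exact: ltW.
  - exact: weighted_primitive_cont.
  - apply: (@Ck_cont _ 0); apply: Ck_sub.
      by apply: Ck_mul => //; split=> //; exact: cont_ge0_powR.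
    by apply: Ck_mul; [exact: Ck_cst|split=> //; exact: weighted_primitive_cont].
  - exact: weighted_primitive_deriv.
  - move=> x x0; apply: has_derive_eq.
      apply: has_derive_sub.
        by apply: has_derive_mul (powR_deriv _ x0) (dg x x0).
      by apply: has_derive_mul (has_derive_const _ _ _) (weighted_primitive_deriv _ _ x0).
    by rewrite addrK; ring.
  - by rewrite /weighted_primitive !primitive0 powR0 ?gt_eqF // mul0r mulr0 subrr.
rewrite averageE ?ltW // averageE ?ltW // in E.
have p0 := powR_gt0 (a + 1) t0.
move: E; rewrite (powRD1 (a + 1)) // => E.
apply: (@mulfI _ (t * t `^ (a + 1))); first by rewrite mulf_neq0 ?gt_eqF.
by rewrite E; field; rewrite gt_eqF.
Qed.

Lemma Ck_average j (a : R) g : 0 < a -> Ck j g -> Ck j (average a g).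
Proof.
elim: j a g => [|j IH] a g a0 Cg; (split; first exact: average_cont (Ck_cont Cg)) => //.
case: (Cg) => cg [g' dg Cg']; exists (average (a + 1) g').
  exact: average_deriv_C1 (Ck_cont Cg') dg.
by apply: IH => //; rewrite addr_gt0.
Qed.

(* The solution of f' + (a / t) f = g that is bounded at t = 0. *)
Definition singular_solve (a : R) g (t : R) : R := t * average a g t.

Section SingularSolve.
Variables (a : R) (a0 : 0 < a).

Lemma singular_solve_deriv g : cont_ge0 g ->
  deriv_gt0 (singular_solve a g) (fun t => g t - a * average a g t).
Proof.
move=> cg t t0; apply: has_derive_eq.
  by apply: has_derive_mul (has_derive_var _) (average_deriv _ cg t0).
by rewrite /= mul1r mulrC divfK ?gt_eqF //; ring.
Qed.

Lemma Ck_singular_solve j g : Ck j g -> Ck j.+1 (singular_solve a g).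
Proof.
move=> Cg; split.
  apply: (@Ck_cont _ 0); apply: Ck_mul; first exact: Ck_id.
  by apply: Ck_average => //; split=> //; exact: (Ck_cont Cg).
exists (fun t => g t - a * average a g t).
  exact: singular_solve_deriv (Ck_cont Cg).
by apply: Ck_sub => //; apply: Ck_mul; [exact: Ck_cst|exact: Ck_average].
Qed.

(** The weight e^(2Lt) makes the Picard map a contraction by 1/2 on the whole half-line at once. The
    majorant (C/2) e^(2Lt) t^a has a derivative exceeding L C e^(2Lt) t^a; the surplus, coming from
    the derivative of t^a, is nonnegative and is dropped. *)
Lemma singular_solve_lip g h (L C : R) : 0 < L -> 0 <= C -> cont_ge0 g -> cont_ge0 h ->
  (forall t, 0 <= t -> `|g t - h t| <= L * C * expR (2 * L * t)) ->
  forall t, 0 <= t ->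
  `|singular_solve a g t - singular_solve a h t| <= C / 2 * expR (2 * L * t).
Proof.
move=> L0 C0 cg ch gh t; rewrite le_eqVlt => /predU1P[<-|t0].
  by rewrite /singular_solve !mul0r subrr normr0 mulr_ge0 ?expR_ge0 // divr_ge0.
have tp := powR_gt0 a t0.
have E k : t `^ a * singular_solve a k t = weighted_primitive a k t.
  by rewrite averageE ?ltW // powRD1 // /singular_solve; ring.
rewrite -(ler_pM2l tp) -{1}(gtr0_norm tp) -normrM mulrBr !E mulrC.
have dE x : has_derive x (1 : R) (fun t : R => expR (2 * L * t)) (expR (2 * L * x) * (2 * L)).
  by apply: has_derive_expR_comp; exact: has_derive_linear.
apply: (@deriv_norm_le R
  (fun t => weighted_primitive a g t - weighted_primitive a h t)
  (fun t => C / 2 * expR (2 * L * t) * t `^ a)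
  (fun t => t `^ a * (g t - h t))
  (fun t => C / 2 * (expR (2 * L * t) * (2 * L)) * t `^ a +
            C / 2 * expR (2 * L * t) * (a * t `^ (a - 1)))).
- by apply: (@Ck_cont _ 0); apply: Ck_sub; split=> //; exact: weighted_primitive_cont.
- apply: (@Ck_cont _ 0); apply: Ck_mul; last by split=> //; exact: cont_ge0_powR.
  apply: Ck_mul; first exact: Ck_cst.
  by apply: Ck_expR; apply: Ck_mul; [exact: Ck_cst|exact: Ck_id].
- by move=> x x0; rewrite mulrBr; apply: has_derive_sub; exact: weighted_primitive_deriv.
- move=> x x0; apply: has_derive_eq.
    apply: has_derive_mul (powR_deriv _ x0).
    by apply: has_derive_mul (has_derive_const _ _ _) (dE _).
  by rewrite mul0r add0r.
- by rewrite /weighted_primitive !primitive0 subrr.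
- by rewrite powR0 ?gt_eqF // mulr0.
- exact: ltW.
- move=> z /andP[z0 _]; rewrite normrM (ger0_norm (powR_ge0 _ _)) ler_wpDr //.
    by rewrite !mulr_ge0 ?powR_ge0 ?expR_ge0 ?divr_ge0 // ltW.
  rewrite mulrC ler_wpM2r ?powR_ge0 // (le_trans (gh z (ltW z0))) //.
  by rewrite le_eqVlt; apply/orP; left; apply/eqP; field.
Qed.

Lemma singular_solve0 (t : R) : 0 <= t -> singular_solve a (fun=> 0) t = 0.
Proof.
move=> t0; have a1 : 0 < a + 1 by rewrite addr_gt0.
rewrite /singular_solve /average; case: ifPn => _; last by rewrite mul0r mulr0.
suff -> : weighted_primitive a (fun=> 0) t = 0 by rewrite mul0r mulr0.
have c0 : cont_ge0 (fun=> 0 : R) by apply: (@Ck_cont R 0); exact: Ck_cst.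
apply: (@deriv_eq R _ (fun=> 0) (fun t => t `^ a * 0)) => //.
- exact: weighted_primitive_cont.
- exact: weighted_primitive_deriv.
- by move=> x x0; rewrite mulr0; exact: has_derive_const.
- exact: primitive0.
Qed.

End SingularSolve.

Lemma exists_small_pow2 (K e : R) : 0 < e -> exists i, K / 2 ^+ i <= e.
Proof.
move=> e0; pose N := Num.truncn (Num.max 0 (K / e)).
have H : K / e < N.+1%:R.
  apply: le_lt_trans (truncnS_gt _).
  by rewrite le_max lexx orbT.
exists N.+1; rewrite ler_pdivrMr ?exprn_gt0 // mulrC -ler_pdivrMr //.
apply: le_trans (ltW H) _; rewrite -natrX ler_nat ltnW //.
exact: ltn_expl.
Qed.

Lemma cont_ge0_approx f :
  (forall b e : R, 0 < b -> 0 < e -> exists2 g, cont_ge0 g &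
     forall t, 0 <= t <= b -> `|f t - g t| <= e) -> cont_ge0 f.
Proof.
move=> H y; apply/cvgrPdist_le => e e0.
have e3 : 0 < e / 3 by rewrite divr_gt0.
have [|g cg fg] := H (`|y| + 1) _ _ e3; first by rewrite ltr_wpDl.
have /cvgrPdist_le/(_ _ e3) := cg y.
have y1 : \forall z \near y, `|y - z| <= 1 by exists 1 => //= z; exact: ltW.
move=> gy; near=> t.
have ty : `|t| <= `|y| + 1.
  rewrite -lerBlDl (le_trans (lerB_dist _ _)) // distrC; near: t.
have := fg _ (introT andP (conj (normr_ge0 y) (ler_wpDr ler01 (lexx _)))).
have := fg _ (introT andP (conj (normr_ge0 t) ty)).
have : `|g `|y| - g `|t| | <= e / 3 by near: t.
move: (f `|y|) (f `|t|) (g `|y|) (g `|t|) => p q r s.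
rewrite !ler_norml => /andP[? ?] /andP[? ?] /andP[? ?]; apply/andP; split; lra.
Unshelve. all: by end_near. Qed.

(** * Picard iteration on the half-line in a weighted supremum norm *)

Section Picard.
Variables (a L M : R) (G : R -> R -> R).
Hypotheses (a0 : 0 < a) (L0 : 0 < L).
Hypothesis Gcont : forall f, cont_ge0 f -> cont_ge0 (fun t => G t (f t)).
Hypothesis Glip : forall t p q, 0 <= t -> `|G t p - G t q| <= L * `|p - q|.
Hypothesis Gbound : forall t, 0 <= t -> `|G t 0| <= L * M.

Let T f := singular_solve a (fun t => G t (f t)).
Let F := fix F j := if j is j'.+1 then T (F j') else fun=> 0.
Let E (t : R) := expR (2 * L * t).

Let E0 t : 0 < E t. Proof. exact: expR_gt0. Qed.

Let M0 : 0 <= M.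
Proof. by rewrite -(pmulr_rge0 _ L0); apply: le_trans (Gbound (lexx 0)). Qed.

Let Tcont f : cont_ge0 f -> cont_ge0 (T f).
Proof.
move=> cf; apply: (@Ck_cont R 0); apply: CkW; apply: Ck_singular_solve => //.
by split=> //; exact: Gcont.
Qed.

Let Fcont j : cont_ge0 (F j).
Proof.
elim: j => [|j IH] /=; last exact: Tcont.
by apply: (@Ck_cont R 0); exact: Ck_cst.
Qed.

Let Tlip f g C : 0 <= C -> cont_ge0 f -> cont_ge0 g ->
  (forall t, 0 <= t -> `|f t - g t| <= C * E t) ->
  forall t, 0 <= t -> `|T f t - T g t| <= C / 2 * E t.
Proof.
move=> C0 cf cg fg; apply: singular_solve_lip => //; [exact: Gcont|exact: Gcont|].
move=> t t0; apply: le_trans (Glip _ _ t0) _; rewrite -mulrA.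
by rewrite ler_pM2l //; exact: fg.
Qed.

Let Fstep j t : 0 <= t -> `|F j.+1 t - F j t| <= M / 2 ^+ j * E t.
Proof.
elim: j t => [|j IH] t t0.
  rewrite /= expr0 divr1 -[X in _ - X](singular_solve0 a0 t0).
  apply: le_trans (_ : M / 2 * E t <= _).
    apply: singular_solve_lip => //; [exact: Gcont (@Fcont 0)|exact: (@Fcont 0)|].
    move=> s s0; rewrite subr0; apply: le_trans (Gbound s0) _.
    rewrite ler_peMr ?(mulr_ge0 (ltW L0)) // -expR0 ler_expR !mulr_ge0 //.
    exact: ltW.
  by rewrite ler_pM2r // ler_pdivrMr // ler_peMr // ler1n.
have -> : M / 2 ^+ j.+1 = M / 2 ^+ j / 2 by rewrite exprS; field.
apply: Tlip => //; [by rewrite divr_ge0 // exprn_ge0|exact: (@Fcont j.+1)].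
Qed.

(** The increments of [F] at least halve at each step, so the intervals of radius twice the j-th
    increment bound are nested. The limit is defined pointwise as the supremum of the lower ends,
    and the nesting directly gives the error estimate [f_approx]. *)
Let lo t j := F j t - 2 * (M / 2 ^+ j) * E t.
Let hi t j := F j t + 2 * (M / 2 ^+ j) * E t.

Let half j : M / 2 ^+ j = 2 * (M / 2 ^+ j.+1).
Proof. by rewrite exprS; field. Qed.

Let lo_nd t : 0 <= t -> nondecreasing_seq (lo t).
Proof.
move=> t0; apply/nondecreasing_seqP => j.
have := Fstep j t0; rewrite /lo half ler_norml => /andP[h _].
rewrite -/F; move: h; move: (F _ t) (F _ t) (E t) (M / _) => p q r u; nra.
Qed.

Let hi_ni t : 0 <= t -> nonincreasing_seq (hi t).
Proof.
move=> t0; apply/nonincreasing_seqP => j.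
have := Fstep j t0; rewrite /hi half ler_norml => /andP[_ h].
rewrite -/F; move: h; move: (F _ t) (F _ t) (E t) (M / _) => p q r u; nra.
Qed.

Let lo_hi t i j : 0 <= t -> lo t i <= hi t j.
Proof.
move=> t0; apply: (le_trans (lo_nd t0 (leq_maxl i j))).
apply: le_trans (hi_ni t0 (leq_maxr i j)).
rewrite /lo /hi lerD2l.
have K0 : 0 <= 2 * (M / 2 ^+ maxn i j) * E t.
  by rewrite !mulr_ge0 ?divr_ge0 ?exprn_ge0 // ltW.
by apply: (le_trans _ K0); rewrite oppr_le0.
Qed.

Let f t := sup (range (lo t)).

Let f_approx t i : 0 <= t -> `|f t - F i t| <= 2 * (M / 2 ^+ i) * E t.
Proof.
move=> t0; rewrite ler_distl; apply/andP; split.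
  apply: ub_le_sup; last by exists i.
  by exists (hi t i) => _ [j _ <-]; exact: lo_hi.
apply: ge_sup; first by exists (lo t i); exists i.
by move=> _ [j _ <-]; exact: lo_hi.
Qed.

Let fcont : cont_ge0 f.
Proof.
apply: cont_ge0_approx => b e b0 e0.
have [i Hi] := exists_small_pow2 (2 * M * E b) e0.
exists (F i); first exact: Fcont.
move=> t /andP[t0 tb]; apply: le_trans (f_approx i t0) (le_trans _ Hi).
have -> : 2 * M * E b / 2 ^+ i = 2 * (M / 2 ^+ i) * E b by field; rewrite expf_neq0 // pnatr_eq0.
rewrite ler_wpM2l ?mulr_ge0 ?divr_ge0 ?exprn_ge0 // ler_expR.
by rewrite ler_wpM2l // mulr_ge0 // ltW.
Qed.

Theorem singular_picard : exists2 f, cont_ge0 f &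
  forall t, 0 <= t -> f t = singular_solve a (fun t => G t (f t)) t.
Proof.
exists f => // t t0; apply/eqP; rewrite -subr_eq0 -normr_le0; apply/ler_addgt0Pl => e e0.
have [i Hi] := exists_small_pow2 (2 * M * E t) e0.
have h1 := f_approx i.+1 t0.
have h2 : `|T f t - F i.+1 t| <= 2 * (M / 2 ^+ i) / 2 * E t.
  apply: (Tlip _ fcont (@Fcont i)) => //; first by rewrite mulr_ge0 // divr_ge0 // exprn_ge0.
  by move=> s s0; exact: f_approx.
rewrite addr0 -/(T f t); apply: le_trans Hi.
have -> : 2 * M * E t / 2 ^+ i = 2 * (M / 2 ^+ i.+1) * E t + 2 * (M / 2 ^+ i) / 2 * E t.
  move: (E t) (exprS 2 i : _ = _ :> R) => u ->.
  by field; rewrite expf_neq0 // pnatr_eq0.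
rewrite (_ : f t - _ = (f t - F i.+1 t) - (T f t - F i.+1 t)); last by rewrite /T; ring.
by apply: le_trans (ler_normB _ _) (lerD h1 h2).
Qed.

End Picard.
End Singular.

(** * The scalar profile equation *)

Section Profile.
Context {R : realType}.

Lemma singular_solve_gt0 (a : R) (g : R -> R) : 0 < a -> cont_ge0 g ->
  (forall t, 0 < t -> 0 < g t) -> forall t, 0 < t -> 0 < singular_solve a g t.
Proof.
move=> a0 cg g0 t t0; rewrite /singular_solve /average t0.
rewrite mulr_gt0 // divr_gt0 ?powR_gt0 //.
rewrite -(primitive0 (fun t : R => t `^ a * g t)).
apply: (deriv_gt0_increasing (weighted_primitive_cont a0 cg)
  (weighted_primitive_deriv a0 cg)) => // x x0.
by rewrite mulr_gt0 ?powR_gt0 ?g0.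
Qed.

Section Phi.
Variables (gam : R) (g0 : 0 < gam) (g1 : gam < 1).

(** Solving (1 + psi) gam (1 - e^(-Lam)) = psi for psi gives psi = gam Phi(Lam) / Phi'(Lam).
    Multiplying the equation for Lam by Phi'(Lam) therefore turns its singular term, a multiple of
    psi/t, into a multiple of Phi(Lam)/t: with Phi(Lam) as unknown the singular part is linear. The
    other term then contains Phi'(Lam), which [PhiN] writes as a function of p = Phi(Lam). *)
Definition Phi (x : R) : R := expR ((1 - gam) * x) - expR (- gam * x).
Definition Phi' (x : R) : R := (1 - gam) * expR ((1 - gam) * x) + gam * expR (- gam * x).
Definition Theta : R -> R := inverse_ge0 Phi.
Definition PhiN (p : R) : R := (1 - gam) * p + expR (- gam * Theta p).

Lemma Phi_deriv (x : R) : has_derive x 1 Phi (Phi' x).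
Proof.
have E c : has_derive x 1 (fun t : R => expR (c * t)) (expR (c * x) * c).
  by apply: has_derive_expR_comp; exact: has_derive_linear.
apply: has_derive_eq (has_derive_sub (E _) (E _)) _.
by rewrite /Phi'; ring.
Qed.

Lemma Phi'_gt0 (x : R) : 0 < Phi' x.
Proof. by rewrite addr_gt0 // mulr_gt0 ?expR_gt0 // subr_gt0. Qed.

Lemma Ck_Phi j : Ck j Phi.
Proof.
by apply: Ck_sub; apply: Ck_expR;
  apply: Ck_mul; [exact: Ck_cst|exact: Ck_id|exact: Ck_cst|exact: Ck_id].
Qed.

Lemma Ck_Phi' j : Ck j Phi'.
Proof.
have H c d : Ck j (fun x : R => c * expR (d * x)).
  by apply: Ck_mul; [exact: Ck_cst|apply: Ck_expR; apply: Ck_mul; [exact: Ck_cst|exact: Ck_id]].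
by apply: Ck_add; exact: H.
Qed.

Lemma Phi0 : Phi 0 = 0.
Proof. by rewrite /Phi !mulr0 subrr. Qed.

Lemma Phi_unbounded (y : R) : exists2 x, 0 <= x & y <= Phi x.
Proof.
have d0 : 0 < 1 - gam by rewrite subr_gt0.
exists (`|y| / (1 - gam)); first by rewrite divr_ge0 // ltW.
have e1 := expR_ge1Dx ((1 - gam) * (`|y| / (1 - gam))).
have e2 : expR (- gam * (`|y| / (1 - gam))) <= 1.
  by rewrite expR_le1 mulNr oppr_le0 mulr_ge0 ?divr_ge0 // ltW.
rewrite /Phi; move: e1; rewrite {1}mulrC divfK ?gt_eqF // => e1.
by apply: le_trans (ler_norm y) _; lra.
Qed.

Let D : deriv_gt0 Phi Phi'. Proof. by move=> x _; exact: Phi_deriv. Qed.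
Let P (x : R) : 0 <= x -> 0 < Phi' x. Proof. by move=> _; exact: Phi'_gt0. Qed.
Let C : cont_ge0 Phi. Proof. exact: (Ck_cont (Ck_Phi 0)). Qed.

Lemma Theta_spec (p : R) : 0 <= p -> 0 <= Theta p /\ Phi (Theta p) = p.
Proof. exact: (inverse_ge0_spec C Phi0 Phi_unbounded). Qed.

Lemma Theta0 : Theta 0 = 0.
Proof. exact: (inverse_ge00 C D P Phi0 Phi_unbounded). Qed.

Lemma Theta_deriv : deriv_gt0 Theta (fun p => (Phi' (Theta p))^-1).
Proof. exact: (inverse_ge0_deriv C D P Phi0 Phi_unbounded). Qed.

Lemma Ck_Theta j : Ck j Theta.
Proof. exact: (inverse_ge0_Ck C D P Phi0 Phi_unbounded j Ck_Phi'). Qed.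

Lemma Theta_le (p q : R) : 0 <= p -> p <= q -> Theta p <= Theta q.
Proof.
move=> p0 pq; apply: (deriv_ge0_nondecreasing (Ck_cont (Ck_Theta 0)) Theta_deriv) => // z _.
by rewrite invr_ge0 ltW // Phi'_gt0.
Qed.

Lemma PhiNE (p : R) : 0 <= p -> PhiN p = Phi' (Theta p).
Proof. by move=> /Theta_spec[_ h]; rewrite /PhiN -{1}h /Phi /Phi'; ring. Qed.

Lemma PhiN_gt0 (p : R) : 0 <= p -> 0 < PhiN p.
Proof. by move=> p0; rewrite PhiNE // Phi'_gt0. Qed.

Lemma PhiN0 : PhiN 0 = 1.
Proof. by rewrite /PhiN Theta0 !mulr0 expR0 add0r. Qed.

(* Phi' - (1 - gam) Phi = e^(- gam x) is decreasing and Phi' + gam Phi =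
   e^((1 - gam) x) is increasing, so |d Phi' / d Phi| <= 1. *)
Lemma PhiN_lip (p q : R) : 0 <= p -> 0 <= q -> `|PhiN p - PhiN q| <= `|p - q|.
Proof.
wlog pq : p q / p <= q.
  move=> H p0 q0; have [pq|qp] := leP p q; first exact: H.
  by rewrite distrC (distrC p); apply: H => //; exact: ltW.
move=> p0 q0; have T := Theta_le p0 pq.
have h1 : expR (- gam * Theta q) <= expR (- gam * Theta p).
  by rewrite ler_expR !mulNr lerN2 ler_pM2l.
have h2 : expR ((1 - gam) * Theta p) <= expR ((1 - gam) * Theta q).
  by rewrite ler_expR ler_pM2l // subr_gt0.
have [_ ep] := Theta_spec p0; have [_ eq] := Theta_spec q0.
move: ep eq; rewrite /PhiN /Phi.
rewrite distrC (distrC p) (ger0_norm (x := q - p)) ?subr_ge0 // => ep eq.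
have : 0 <= gam * (q - p) by rewrite mulr_ge0 ?subr_ge0 // ltW.
have : 0 <= (1 - gam) * (q - p) by rewrite mulr_ge0 ?subr_ge0 // ltW.
by rewrite ler_norml => ? ?; apply/andP; split; lra.
Qed.

End Phi.

Section ODE.
Variables (n k : nat) (kap : R).
Hypotheses (k0 : (0 < k)%N) (kn : (k <= n)%N) (n2k : (n < 2 * k)%N) (kap2 : 2 <= kap).

Let K : R := k%:R.
Let gam : R := n%:R / (2 * K).
Let K0 : 0 < K. Proof. by rewrite /K ltr0n. Qed.
Let n0 : 0 < n%:R :> R. Proof. by rewrite ltr0n (leq_trans k0). Qed.
Let g0 : 0 < gam. Proof. by rewrite divr_gt0 // mulr_gt0. Qed.
Let g1 : gam < 1.
Proof. by rewrite ltr_pdivrMr ?mulr_gt0 // mul1r -natrM ltr_nat. Qed.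

Let w (t : R) : R := (1 + t) ^+ n.
Let q (t : R) : R := (1 + t) * (kap + (kap - 2) * t).
(** With K gam = n/2 and (1 - t)/(t (1 + t)) = 1/t - 2/(1 + t), the unknown Phi(Lam) has the linear
    coefficient -(n/2)(1/t - 2/(1 + t)). Dividing by [w] absorbs the regular part and leaves (n/2)/t
    on the left and [G] on the right. The absolute value extends [G] to all real p without spoiling
    the Lipschitz bound; the solution is nonnegative, so it disappears later. *)
Let G (t p : R) : R := 2 * K / q t * (PhiN gam `|w t * p| / w t).

Let t1 (t : R) : 0 <= t -> 0 < 1 + t. Proof. by move=> ?; rewrite ltr_wpDr. Qed.
Let w0 t : 0 <= t -> 0 < w t. Proof. by move=> h; rewrite exprn_gt0 // t1. Qed.
Let kt t : 0 <= t -> 2 <= kap + (kap - 2) * t.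
Proof. by move=> h; rewrite ler_wpDr // mulr_ge0 // subr_ge0. Qed.
Let q0 t : 0 <= t -> 0 < q t.
Proof. by move=> h; rewrite mulr_gt0 ?t1 // (lt_le_trans _ (kt h)). Qed.
Let q2 t : 0 <= t -> 2 <= q t.
Proof. by move=> h; rewrite /q -[leLHS]mul1r ler_pM ?kt // lerDl. Qed.

Let Ck_1t j : Ck j (fun t : R => 1 + t).
Proof. by apply: Ck_add; [exact: Ck_cst|exact: Ck_id]. Qed.
Let Ck_kt j : Ck j (fun t => kap + (kap - 2) * t).
Proof. by apply: Ck_add; [exact: Ck_cst|apply: Ck_mul; [exact: Ck_cst|exact: Ck_id]]. Qed.
Let Ck_w j : Ck j w. Proof. exact: Ck_exp. Qed.
Let Ck_q j : Ck j q. Proof. exact: Ck_mul. Qed.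
Let Ck_2Kq j : Ck j (fun t => 2 * K / q t).
Proof. by apply: Ck_div => //; [move=> t h; rewrite gt_eqF // q0|exact: Ck_cst]. Qed.

Let Gcont f : cont_ge0 f -> cont_ge0 (fun t => G t (f t)).
Proof.
move=> cf; apply: cont_ge0_mul; first exact: (Ck_cont (Ck_2Kq 0)).
apply: (@cont_ge0_mul R (fun t => PhiN gam `|w t * f t|) (fun t => (w t)^-1)).
  have cN : cont_ge0 (PhiN gam).
    apply: (@Ck_cont R 0); apply: Ck_add.
      by apply: Ck_mul; [exact: Ck_cst|exact: Ck_id].
    by apply: Ck_expR; apply: Ck_mul; [exact: Ck_cst|exact: Ck_Theta].
  have cwf : cont_ge0 (fun t => w t * f t) by apply: cont_ge0_mul => //; exact: (Ck_cont (Ck_w 0)).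
  by apply: (@cont_ge0_outer R (fun p => PhiN gam `|p|)) => // x _; exact: cN.
by apply: (@Ck_cont R 0); apply: Ck_inv => // t h; rewrite gt_eqF // w0.
Qed.

Let gK t : 0 <= t -> 0 <= 2 * K / q t <= K.
Proof.
move=> h; apply/andP; split.
  by rewrite divr_ge0 // ltW ?q0 // mulr_gt0.
by rewrite ler_pdivrMr ?q0 // mulrC ler_pM2l // q2.
Qed.

Let Glip t x y : 0 <= t -> `|G t x - G t y| <= K * `|x - y|.
Proof.
move=> h; have wp := w0 h; have /andP[gp gk] := gK h.
rewrite /G -mulrBr -mulrBl normrM (ger0_norm gp) normrM normfV (gtr0_norm wp).
apply: ler_pM => //; first by rewrite mulr_ge0 // invr_ge0 ltW.
rewrite ler_pdivrMr // (le_trans (PhiN_lip g0 g1 _ _)) //.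
by rewrite (le_trans (ler_dist_dist _ _)) // -mulrBr normrM (gtr0_norm wp) mulrC.
Qed.

Let Gbound t : 0 <= t -> `|G t 0| <= K * 1.
Proof.
move=> h; have wp := w0 h; have /andP[gp gk] := gK h.
rewrite /G mulr0 normr0 PhiN0 // mul1r normrM (ger0_norm gp) normfV (gtr0_norm wp).
apply: ler_pM => //; first by rewrite invr_ge0 ltW.
by rewrite invf_le1 // exprn_ege1 // lerDl.
Qed.

(* With y = 2t/(1+t) the parameter and Lam the logarithmic deficit from the
   spherical profile, Phi(Lam)/(1+t)^n solves an equation with globally
   Lipschitz right-hand side and a linear singular part. *)
Lemma profile_exists : exists Lam psi : R -> R,
  [/\ (forall j, Ck j Lam), (forall j, Ck j psi), Lam 0 = 0,
      (forall t, 0 <= t ->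
        [/\ 0 <= Lam t, 0 <= psi t, psi t <= gam / (1 - gam) &
         (1 + psi t) * (gam * (1 - expR (- Lam t))) = psi t]) &
      deriv_gt0 Lam (fun t => 2 * K / q t - K * (1 - t) * psi t / (t * (1 + t)))].
Proof.
have a0 : 0 < n%:R / 2 :> R by rewrite divr_gt0.
have [Psi cPsi Psi_eq] := singular_picard a0 K0 Gcont Glip Gbound.
have cG := Gcont cPsi.
have G0 t : 0 <= t -> 0 < G t (Psi t).
  move=> h; have N0 := PhiN_gt0 g0 g1 (normr_ge0 (w t * Psi t)).
  have [qp wp] := (q0 h, w0 h).
  by rewrite /G mulr_gt0 // divr_gt0 // mulr_gt0.
have Psi0 t : 0 < t -> 0 < Psi t.
  move=> h; rewrite Psi_eq ?ltW //.
  by apply: singular_solve_gt0 => // s /ltW; exact: G0.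
have Psi00 : Psi 0 = 0 by rewrite Psi_eq // /singular_solve mul0r.
have wPsi0 t : 0 < t -> 0 < w t * Psi t.
  by move=> h; rewrite mulr_gt0 ?Psi0 ?w0 // ltW.
have wPsi t : 0 <= t -> 0 <= w t * Psi t.
  by rewrite le_eqVlt => /predU1P[<-|/wPsi0/ltW //]; rewrite Psi00 mulr0.
have CkTh j : Ck j Psi -> Ck j (fun t => Theta gam (w t * Psi t)).
  by move=> CP; apply: Ck_comp => //; [exact: Ck_Theta|exact: Ck_mul].
(* Bootstrap: the right-hand side is as regular as [Psi], and [singular_solve] gains one derivative.
   Nonnegativity of [Psi] removes the absolute value, which is not smooth. *)
have CkPsi j : Ck j Psi.
  elim: j => [|j IH]; first by split.
  apply: (@Ck_eq _ _ (singular_solve (n%:R / 2) (fun t => G t (Psi t)))).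
    by move=> t h; rewrite -Psi_eq.
  apply: Ck_singular_solve => //.
  apply: (@Ck_eq _ _ (fun t => 2 * K / q t * (PhiN gam (w t * Psi t) / w t))).
    by move=> t h; rewrite /G ger0_norm // wPsi.
  apply: Ck_mul => //; apply: Ck_div => //; first by move=> t h; rewrite gt_eqF // w0.
  apply: Ck_add; first by apply: Ck_mul; [exact: Ck_cst|exact: Ck_mul].
  by apply: Ck_expR; apply: Ck_mul; [exact: Ck_cst|exact: CkTh].
pose Lam t := Theta gam (w t * Psi t).
have CkL j : Ck j Lam by exact: CkTh.
have Lam0 t : 0 <= t -> 0 <= Lam t /\ Phi gam (Lam t) = w t * Psi t.
  by move=> h; exact: Theta_spec (wPsi t h).
(* This is the solution of (1 + psi) gam (1 - e^(-Lam)) = psi, with numerator and denominator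
   multiplied by e^((1 - gam) Lam). Its denominator is positive because gam < 1. *)
pose psi t := gam * Phi gam (Lam t) / Phi' gam (Lam t).
have P' := Phi'_gt0 g0 g1.
exists Lam, psi; split => //.
- move=> j.
  apply: (@Ck_eq _ _ (fun t => gam * (w t * Psi t) / Phi' gam (Lam t))).
    by move=> t h; rewrite /psi; have [_ ->] := Lam0 t h.
  apply: Ck_div; first by move=> t _; rewrite gt_eqF.
    by apply: Ck_mul; [exact: Ck_cst|exact: Ck_mul].
  rewrite /Phi'.
  by apply: Ck_add; (apply: Ck_mul; [exact: Ck_cst|]); apply: Ck_expR;
    apply: Ck_mul => //; exact: Ck_cst.
- by rewrite /Lam Psi00 mulr0 Theta0.
- move=> t h; have [L0 EL] := Lam0 t h.
  have d1 : 0 < 1 - gam by rewrite subr_gt0.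
  have Phi_ge0 : 0 <= Phi gam (Lam t) by rewrite EL wPsi.
  have e1 := expR_gt0 ((1 - gam) * Lam t); have e2 := expR_gt0 (- gam * Lam t).
  split=> //.
  + by rewrite /psi divr_ge0 // ?(ltW (P' _)) // mulr_ge0 // (ltW g0).
  + rewrite /psi -mulrA ler_pM2l // ler_pdivrMr // mulrC ler_pdivlMr //.
    rewrite /Phi /Phi'; move: (expR _) (expR _) e1 e2 => x y x0 y0.
    have : 0 <= (1 - gam) * y by rewrite mulr_ge0 // ltW.
    have : 0 <= gam * y by rewrite mulr_ge0 // ltW.
    nra.
  + have E : expR (- gam * Lam t) = expR ((1 - gam) * Lam t) * expR (- Lam t).
      by rewrite -expRD; congr expR; ring.
    rewrite /psi; move: (P' (Lam t)) e1; rewrite /Phi /Phi' E.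
    move: (expR _) (expR _) => x y D0 y0; field.
    by rewrite gt_eqF.
- move=> t t0; have [L0 EL] := Lam0 t (ltW t0).
  have dPsi : has_derive t 1 Psi (G t (Psi t) - n%:R / 2 * Psi t / t).
    apply: (@has_derive_eq_gt0 _ (singular_solve (n%:R / 2) (fun t => G t (Psi t)))) => //.
      by move=> s /ltW h; rewrite -Psi_eq.
    apply: has_derive_eq (singular_solve_deriv a0 cG t0) _.
    have E : Psi t = average (n%:R / 2) (fun t => G t (Psi t)) t * t.
      by rewrite {1}Psi_eq ?ltW // /singular_solve mulrC.
    rewrite -[_ * Psi t / t]mulrA; congr (_ - _ * _).
    by rewrite [X in _ = X / _]E mulfK // gt_eqF.
  have dw : has_derive t 1 w (n%:R * w t / (1 + t)).
    have H : has_derive t 1 (fun t : R => 1 + t) 1.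
      by apply: has_derive_eq (has_derive_add (has_derive_const _ _ _) (has_derive_var _)) _;
        rewrite add0r.
    apply: has_derive_eq (has_derive_exp n H) _.
    have E : (1 + t) ^+ n = (1 + t) * (1 + t) ^+ n.-1.
      by rewrite -exprS prednK // (leq_trans k0 kn).
    rewrite /w E; field.
    by rewrite gt_eqF // t1 // ltW.
  have dL := @has_derive_comp R (Theta gam) (fun t => w t * Psi t) t _ _
    (Theta_deriv g0 g1 (wPsi0 t t0)) (has_derive_mul dw dPsi).
  apply: has_derive_eq dL _.
  rewrite -/(Lam t) /G (ger0_norm (wPsi _ (ltW t0))) PhiNE ?wPsi ?ltW // -/(Lam t).
  have tt := t1 (ltW t0); have ww := w0 (ltW t0); have qq := q0 (ltW t0).
  have pp := P' (Lam t).
  rewrite /psi EL.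
  have -> : K = n%:R / 2 / gam.
    by rewrite /gam; field; rewrite !gt_eqF.
  move: (Phi' _ _) (w t) (Psi t) (q t) pp ww qq => x y z u ? ? ?.
  by field; rewrite !gt_eqF.
Qed.

End ODE.
End Profile.

(** * The radial solution in terms of the squared radius *)

Section RadialSolution.
Context {R : realType}.
Variables (n k : nat) (kap v0 lam : R).
Hypotheses (k0 : (0 < k)%N) (kn : (k <= n)%N) (n2k : (n < 2 * k)%N) (kap2 : 2 <= kap).
Hypotheses (v00 : 0 < v0) (lam0 : 0 < lam).

Let K : R := k%:R.
Let gam : R := n%:R / (2 * K).
Let K0 : 0 < K. Proof. by rewrite /K ltr0n. Qed.

Section Parametrized.
Variables Lam psi : R -> R.
Hypotheses (CL : forall j, Ck j Lam) (Cp : forall j, Ck j psi) (L0 : Lam 0 = 0).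
Hypothesis psi0 : forall t, 0 <= t -> 0 <= psi t.
Hypothesis dL : deriv_gt0 Lam (fun t => 2 * K / ((1 + t) * (kap + (kap - 2) * t))
  - K * (1 - t) * psi t / (t * (1 + t))).

Let t1 (t : R) : 0 <= t -> 0 < 1 + t. Proof. by move=> ?; rewrite ltr_wpDr. Qed.
Let D (t : R) := kap + (kap - 2) * t.
Let D0 t : 0 <= t -> 0 < D t.
Proof.
by move=> h; rewrite ltr_wpDr ?mulr_ge0 ?subr_ge0 // (lt_le_trans _ kap2).
Qed.
Let p1 t : 0 <= t -> 0 < 1 + psi t. Proof. by move=> /psi0 ?; rewrite ltr_wpDr. Qed.

Let Ck_1t j : Ck j (fun t : R => 1 + t).
Proof. by apply: Ck_add; [exact: Ck_cst|exact: Ck_id]. Qed.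
Let Ck_D j : Ck j D.
Proof. by apply: Ck_add; [exact: Ck_cst|apply: Ck_mul; [exact: Ck_cst|exact: Ck_id]]. Qed.
Let Ck_1p j : Ck j (fun t : R => 1 + psi t).
Proof. by apply: Ck_add; [exact: Ck_cst|exact: Cp]. Qed.

Let d1t (t : R) : has_derive t 1 (fun t : R => 1 + t) 1.
Proof.
by apply: has_derive_eq (has_derive_add (has_derive_const _ _ _) (has_derive_var _)) _;
  rewrite add0r.
Qed.
Let dD (t : R) : has_derive t 1 D (kap - 2).
Proof.
by apply: has_derive_eq (has_derive_add (has_derive_const _ _ _) (has_derive_linear _ _)) _;
  rewrite add0r.
Qed.

(** From s V_s / V = t/(1+t) and ds/s = (1 + psi) dt/t follows d(ln V)/dt = (1 + psi)/(1 + t). Thus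
    [growth] is the logarithm of the ratio of V to the spherical profile v0 (1 + t). *)
Definition growth := primitive (fun t => psi t / (1 + t)).

Lemma Ck_growth j : Ck j growth.
Proof.
apply: CkW; apply: Ck_primitive; apply: Ck_div => //.
by move=> t /t1 h; rewrite gt_eqF.
Qed.

Lemma growth_deriv : deriv_gt0 growth (fun t => psi t / (1 + t)).
Proof.
apply: primitive_deriv; apply: (@Ck_cont _ 0); apply: Ck_div => //.
by move=> t /t1 h; rewrite gt_eqF.
Qed.

(** This is s/t, read off from the radial equation lam V V_s = v0^2 (kap + (kap - 2) t) e^(Lam/k)
    after inserting V = [factor] and V_s = [factor_slope]. The equation thus holds by construction;
    what remains to be proved is that [factor_slope] is indeed the s-derivative of [factor]. *)
Definition sq_ratio t := lam * (1 + t) * expR (2 * growth t - Lam t / K) / D t.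
Definition sq_radius t := t * sq_ratio t.
Definition factor t := v0 * expR (growth t) * (1 + t).
Definition factor_slope t := v0 * expR (growth t) / sq_ratio t.

Lemma sq_ratio_gt0 t : 0 <= t -> 0 < sq_ratio t.
Proof. by move=> h; rewrite divr_gt0 ?D0 // !mulr_gt0 ?expR_gt0 ?t1. Qed.

Let Ck_exp1 j : Ck j (fun t => expR (2 * growth t - Lam t / K)).
Proof.
apply: Ck_expR; apply: Ck_sub; first by apply: Ck_mul; [exact: Ck_cst|exact: Ck_growth].
by apply: Ck_mul; [exact: CL|exact: Ck_cst].
Qed.

Lemma Ck_sq_ratio j : Ck j sq_ratio.
Proof.
apply: Ck_div; [by move=> t /D0 h; rewrite gt_eqF| |exact: Ck_D].
by apply: Ck_mul => //; apply: Ck_mul => //; exact: Ck_cst.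
Qed.

(** The equation [dL] for [Lam] is used here: it is equivalent to the logarithmic derivative of s/t
    being psi/t, that is, to ds/s = (1 + psi) dt/t. *)
Lemma sq_ratio_deriv : deriv_gt0 sq_ratio (fun t => sq_ratio t * psi t / t).
Proof.
move=> t t0; have d0 := D0 (ltW t0); have tt := t1 (ltW t0).
have dE : has_derive t 1 (fun t => expR (2 * growth t - Lam t / K))
    (expR (2 * growth t - Lam t / K) * (2 * (psi t / (1 + t)) -
      (2 * K / ((1 + t) * D t) - K * (1 - t) * psi t / (t * (1 + t))) / K)).
  apply: has_derive_expR_comp; apply: has_derive_sub.
    apply: has_derive_eq (has_derive_mul (has_derive_const 2 _ _) (growth_deriv t0)) _.
    by rewrite mul0r add0r.
  apply: has_derive_eq (has_derive_mul (dL t0) (has_derive_const K^-1 _ _)) _.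
  by rewrite mulr0 addr0.
have H := has_derive_mul (has_derive_mul (has_derive_mul (has_derive_const lam _ _) (d1t t)) dE)
  (has_derive_inv (lt0r_neq0 d0) (dD t)).
apply: has_derive_eq H _.
rewrite /sq_ratio; move: (expR _) (psi t) => x p.
have := d0; rewrite /D => d0'.
by field; rewrite !gt_eqF.
Qed.

Lemma sq_radius_deriv : deriv_gt0 sq_radius (fun t => sq_ratio t * (1 + psi t)).
Proof.
move=> t t0; apply: has_derive_eq (has_derive_mul (has_derive_var t) (sq_ratio_deriv t0)) _.
by rewrite /=; field; rewrite gt_eqF.
Qed.

Lemma sq_ratio_ge t : 0 <= t -> sq_ratio 0 <= sq_ratio t.
Proof.
move=> h; apply: (deriv_ge0_nondecreasing (Ck_cont (Ck_sq_ratio 0)) sq_ratio_deriv) => //.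
move=> z /andP[z0 _].
have zz := ltW z0; have r0 := ltW (sq_ratio_gt0 zz).
by rewrite divr_ge0 // mulr_ge0 // psi0.
Qed.

(** As psi >= 0, s/t does not decrease and s >= sq_ratio(0) t. The parametrization therefore reaches
    every radius, and the solution is defined on the whole space. *)
Lemma sq_radius_unbounded y : exists2 t, 0 <= t & y <= sq_radius t.
Proof.
have r0 := sq_ratio_gt0 (lexx 0).
have h : 0 <= `|y| / sq_ratio 0 by rewrite divr_ge0 // ltW.
exists (`|y| / sq_ratio 0) => //; apply: le_trans (ler_norm y) _.
rewrite -{1}(divfK (lt0r_neq0 r0) `|y|) /sq_radius; apply: ler_wpM2l => //.
exact: sq_ratio_ge.
Qed.

Let cs : cont_ge0 sq_radius.
Proof. by apply: (@Ck_cont _ 0); apply: Ck_mul; [exact: Ck_id|exact: Ck_sq_ratio]. Qed.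
Let s'0 t : 0 <= t -> 0 < sq_ratio t * (1 + psi t).
Proof. by move=> h; rewrite mulr_gt0 ?sq_ratio_gt0 ?p1. Qed.
Let s0 : sq_radius 0 = 0. Proof. by rewrite /sq_radius mul0r. Qed.

Definition parameter := inverse_ge0 sq_radius.

Let eta_spec s : 0 <= s -> 0 <= parameter s /\ sq_radius (parameter s) = s.
Proof. exact: (inverse_ge0_spec cs s0 sq_radius_unbounded). Qed.
Let eta0 : parameter 0 = 0.
Proof. exact: (inverse_ge00 cs sq_radius_deriv s'0 s0 sq_radius_unbounded). Qed.
Let eta_gt0 s : 0 < s -> 0 < parameter s.
Proof. exact: (inverse_ge0_gt0 cs s0 sq_radius_unbounded). Qed.
Let eta_deriv : deriv_gt0 parameter
  (fun y => (sq_ratio (parameter y) * (1 + psi (parameter y)))^-1).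
Proof. exact: (inverse_ge0_deriv cs sq_radius_deriv s'0 s0 sq_radius_unbounded). Qed.
Let Ck_eta j : Ck j parameter.
Proof.
apply: (inverse_ge0_Ck cs sq_radius_deriv s'0 s0 sq_radius_unbounded) => i.
by apply: Ck_mul => //; exact: Ck_sq_ratio.
Qed.

Lemma Ck_factor j : Ck j factor.
Proof.
apply: Ck_mul => //; apply: Ck_mul; first exact: Ck_cst.
by apply: Ck_expR; exact: Ck_growth.
Qed.

Lemma Ck_factor_slope j : Ck j factor_slope.
Proof.
apply: Ck_div; [by move=> t /sq_ratio_gt0 h; rewrite gt_eqF| |exact: Ck_sq_ratio].
by apply: Ck_mul; [exact: Ck_cst|apply: Ck_expR; exact: Ck_growth].
Qed.

Let dJ (t : R) : 0 < t -> has_derive t 1 (fun t => v0 * expR (growth t))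
  (v0 * expR (growth t) * (psi t / (1 + t))).
Proof.
move=> t0.
have H := has_derive_mul (has_derive_const v0 t 1) (has_derive_expR_comp (growth_deriv t0)).
by apply: has_derive_eq H _; rewrite mul0r add0r mulrA.
Qed.

Lemma factor_deriv : deriv_gt0 factor (fun t => factor t * (1 + psi t) / (1 + t)).
Proof.
move=> t t0; have tt := t1 (ltW t0).
apply: has_derive_eq (has_derive_mul (dJ t0) (d1t t)) _.
by rewrite /factor; field; rewrite gt_eqF.
Qed.

Lemma factor_slope_deriv : deriv_gt0 factor_slope
  (fun t => - factor_slope t * psi t / (t * (1 + t))).
Proof.
move=> t t0; have tt := t1 (ltW t0); have r0 := sq_ratio_gt0 (ltW t0).
apply: has_derive_eq (has_derive_mul (dJ t0)
  (has_derive_inv (lt0r_neq0 r0) (sq_ratio_deriv t0))) _.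
rewrite /factor_slope; move: (expR _) (sq_ratio t) r0 => x r r0.
by field; rewrite !gt_eqF.
Qed.

Lemma factor_slope_gt0 t : 0 <= t -> 0 < factor_slope t.
Proof. by move=> h; rewrite divr_gt0 ?sq_ratio_gt0 // mulr_gt0 ?expR_gt0. Qed.

Lemma factor_gt0 t : 0 <= t -> 0 < factor t.
Proof. by move=> h; rewrite !mulr_gt0 ?expR_gt0 ?t1. Qed.

Let V s := factor (parameter s).
Let V1 s := factor_slope (parameter s).

Lemma factor_param_deriv : deriv_gt0 V V1.
Proof.
move=> s sp; have ep := eta_gt0 sp; have ee := ltW ep.
have H := has_derive_comp (factor_deriv ep) (eta_deriv sp).
have tt := t1 ee; have r0 := sq_ratio_gt0 ee; have pp := p1 ee.
apply: has_derive_eq H _; rewrite /V1 /factor_slope /factor.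
by move: (expR _) => x; field; rewrite !gt_eqF.
Qed.

Lemma factor_slope_param_deriv : deriv_gt0 V1
  (fun s => - V1 s * psi (parameter s) /
     (s * (1 + parameter s) * (1 + psi (parameter s)))).
Proof.
move=> s sp; have ep := eta_gt0 sp; have ee := ltW ep.
have H := has_derive_comp (factor_slope_deriv ep) (eta_deriv sp).
have tt := t1 ee; have r0 := sq_ratio_gt0 ee; have pp := p1 ee.
apply: has_derive_eq H _; have [_ E] := eta_spec (ltW sp).
move: E; rewrite /V1 /sq_radius.
move: (parameter s) ep ee tt r0 pp => e ep ee tt r0 pp <-.
by move: (factor_slope e) => x; field; rewrite !gt_eqF.
Qed.

(** The logarithmic derivative of the slope is -psi/(t(1+t)), at least -B/(t(1+t)), which is
    integrable at infinity; hence the slope stays away from 0. The multiplier e^(-2B/(1+t)) has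
    logarithmic derivative 2B/(1+t)^2, at least B/(t(1+t)) for t >= 1, so the product is
    nondecreasing there. *)
Lemma factor_slope_bound (B : R) : (forall t, 0 <= t -> psi t <= B) ->
  forall t, 1 <= t -> factor_slope 1 * expR (- B) <= factor_slope t.
Proof.
move=> pB t tge; have t0 : 0 < t by exact: lt_le_trans tge.
have B0 : 0 <= B by apply: le_trans (pB 0 _); rewrite ?psi0.
have dG (x : R) : 0 < x -> has_derive x 1 (fun x => factor_slope x * expR (- (2 * B) / (1 + x)))
  (factor_slope x * expR (- (2 * B) / (1 + x)) *
     (2 * B / (1 + x) ^+ 2 - psi x / (x * (1 + x)))).
  move=> x0; have xx := t1 (ltW x0).
  have H1 := has_derive_mul (has_derive_const (- (2 * B)) x 1)
    (has_derive_inv (lt0r_neq0 xx) (d1t x)).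
  apply: has_derive_eq (has_derive_mul (factor_slope_deriv x0) (has_derive_expR_comp H1)) _.
  by move: (factor_slope x) (expR _) => a b; field; rewrite !gt_eqF.
have cG : cont_ge0 (fun x => factor_slope x * expR (- (2 * B) / (1 + x))).
  apply: (@Ck_cont _ 0); apply: Ck_mul; first exact: Ck_factor_slope.
  apply: Ck_expR; apply: Ck_div; [by move=> x /t1 h; rewrite gt_eqF|exact: Ck_cst|exact: Ck_1t].
have := deriv_ge0_nondecreasing cG dG ler01 tge.
rewrite (_ : - (2 * B) / (1 + 1) = - B); last by field.
move=> H; apply: le_trans (H _) _.
  move=> z /andP[z1 _]; have z0 : 0 < z by exact: lt_trans z1.
  have zz := t1 (ltW z0).
  rewrite mulr_ge0 //; first by rewrite mulr_ge0 ?expR_ge0 // ltW // factor_slope_gt0 // ltW.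
  rewrite subr_ge0 ler_pdivrMr ?mulr_gt0 // (le_trans (pB z (ltW z0))) //.
  rewrite (_ : 2 * B / (1 + z) ^+ 2 * (z * (1 + z)) = B * (2 * z / (1 + z))); last first.
    by field; rewrite gt_eqF.
  by rewrite ler_peMr // ler_pdivlMr // mul1r; lra.
rewrite ler_piMr ?(ltW (factor_slope_gt0 (ltW t0))) // expR_le1.
by rewrite mulNr oppr_le0 divr_ge0 ?mulr_ge0 // ltW // t1 // ltW.
Qed.

Lemma radial_solution_param (B : R) :
  (forall t, 0 <= t -> 0 <= Lam t) -> (forall t, 0 <= t -> psi t <= B) ->
  (forall t, 0 <= t -> (1 + psi t) * (gam * (1 - expR (- Lam t))) = psi t) ->
  exists V V1 V2 eta Lam : R -> R,
  [/\ (forall j, Ck j V), V 0 = v0,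
      deriv_gt0 V V1 /\ cont_ge0 V1, deriv_gt0 V1 V2 /\ cont_ge0 V2 &
  [/\ forall s, 0 <= s -> [/\ 0 < V s, 0 < V1 s, 0 <= eta s & 0 <= Lam s],
      forall s, 0 <= s -> s * V1 s * (1 + eta s) = V s * eta s,
      forall s, 0 <= s ->
        s * V2 s * (1 + eta s) = - (V1 s * (gam * (1 - expR (- Lam s)))),
      forall s, 0 <= s ->
        V s * V1 s * lam = v0 ^+ 2 * (kap + (kap - 2) * eta s) * expR (Lam s / K) &
      exists c S, [/\ 0 < c, 0 < S & forall s, S <= s -> c * s <= V s]]].
Proof.
move=> Lam0 pB pE; exists V, V1.
have eta_ge0 s : 0 <= s -> 0 <= parameter s by move=> /eta_spec[].
have CV1 j : Ck j V1 by apply: Ck_comp => //; exact: Ck_factor_slope.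
(* The second derivative is taken from the regularity of [V1], which supplies continuity up to s =
   0. The explicit formula divides by s and is matched with [V2] only for s > 0, by uniqueness of
   derivatives. *)
have [cV1 [V2 dV2 CV2]] := CV1 1%N.
exists V2, parameter, (fun s => Lam (parameter s)); split => //.
- by move=> j; apply: Ck_comp => //; exact: Ck_factor.
- by rewrite /V eta0 /factor /growth primitive0 expR0 addr0 !mulr1.
- by split => //; exact: factor_param_deriv.
- by split => //; case: CV2.
split.
- move=> s /eta_ge0 h; split=> //; [exact: factor_gt0|exact: factor_slope_gt0|exact: Lam0].
- move=> s h; have [e0 E] := eta_spec h; rewrite /V /V1 -{1}E /sq_radius /factor_slope /factor.
  have r0 := sq_ratio_gt0 e0.
  by move: (expR _) => x; field; rewrite gt_eqF.
- move=> s; rewrite le_eqVlt => /predU1P[<-|h].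
    by rewrite eta0 L0 oppr0 expR0 subrr !mulr0 oppr0 !mul0r.
  have e0 := eta_gt0 h; have ee := ltW e0.
  rewrite (has_derive_unique (dV2 s h) (factor_slope_param_deriv h)) -{1}(pE _ ee).
  have tt := t1 ee; have pp := p1 ee.
  by move: (expR _) => x; field; rewrite !gt_eqF.
- move=> s h; have [e0 E] := eta_spec h.
  have tt := t1 e0; have d0 := D0 e0.
  have E2 (g l : R) : expR (2 * g - l) = expR g * expR g / expR l.
    by rewrite expRB (_ : 2 * g = g + g) ?expRD //; ring.
  rewrite /V /V1 /factor_slope /sq_ratio /factor E2 -/(D _).
  have := expR_gt0 (growth (parameter s)); have := expR_gt0 (Lam (parameter s) / K).
  move: (expR _) (expR _) (D _) d0 => x y d d0 x0 y0.
  by field; rewrite !gt_eqF.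
- exists (factor_slope 1 * expR (- B)), (sq_radius 1); split.
  + by rewrite mulr_gt0 ?expR_gt0 // factor_slope_gt0.
  + by rewrite /sq_radius mul1r sq_ratio_gt0.
  + move=> s hs; have sp : 0 < s by apply: lt_le_trans hs; rewrite /sq_radius mul1r sq_ratio_gt0.
    have [e0 E] := eta_spec (ltW sp).
    have e1 : 1 <= parameter s.
      rewrite leNgt; apply/negP => h1.
      have := deriv_gt0_increasing cs sq_radius_deriv
        (fun x (h : 0 < x) => s'0 (ltW h)) e0 h1.
      by rewrite E ltNge hs.
    (* The lower bound on the slope gives linear growth because s V1 = v0 e^growth t <= v0 e^growth
       (1 + t) = V. *)
    rewrite mulrC; apply: le_trans (ler_wpM2l (ltW sp) (factor_slope_bound pB e1)) _.
    have r0 := sq_ratio_gt0 e0; rewrite -{1}E /sq_radius /V /factor_slope /factor.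
    have := expR_gt0 (growth (parameter s)).
    move: (expR _) (sq_ratio _) r0 => x r r0 x0.
    have -> : parameter s * r * (v0 * x / r) = v0 * x * parameter s.
      by field; rewrite gt_eqF.
    by rewrite ler_wpM2l ?lerDr // ltW // mulr_gt0.
Qed.

End Parametrized.

Lemma radial_solution_exists : exists V V1 V2 eta Lam : R -> R,
  [/\ (forall j, Ck j V), V 0 = v0,
      deriv_gt0 V V1 /\ cont_ge0 V1, deriv_gt0 V1 V2 /\ cont_ge0 V2 &
  [/\ forall s, 0 <= s -> [/\ 0 < V s, 0 < V1 s, 0 <= eta s & 0 <= Lam s],
      forall s, 0 <= s -> s * V1 s * (1 + eta s) = V s * eta s,
      forall s, 0 <= s ->
        s * V2 s * (1 + eta s) = - (V1 s * (gam * (1 - expR (- Lam s)))),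
      forall s, 0 <= s ->
        V s * V1 s * lam = v0 ^+ 2 * (kap + (kap - 2) * eta s) * expR (Lam s / K) &
      exists c S, [/\ 0 < c, 0 < S & forall s, S <= s -> c * s <= V s]]].
Proof.
have [Lam [psi [CL Cp L0 H dL]]] := profile_exists k0 kn n2k kap2.
apply: (radial_solution_param CL Cp L0 _ dL (B := gam / (1 - gam))) => t /H[] //.
Qed.
End RadialSolution.

(** * Elementary symmetric functions of a rank-one perturbation of a scalar matrix *)

Section Sigma.
Context {R : realType}.

Lemma prod_XaddC_coef (n k : nat) (l : 'rV[R]_n) : (k <= n)%N ->
  (\prod_i ('X + (l 0 i)%:P))`_(n - k) = esymf k l.
Proof.
move=> kn; rewrite (eq_bigr (fun i => (l 0 i)%:P + 'X)); last by move=> i _; rewrite addrC.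
rewrite (bigA_distr _ _ (fun i => (l 0 i)%:P) (fun=> 'X)) coef_sum /esymf [RHS]big_mkcond /=.
apply: eq_big => [J|J _]; first by rewrite inE.
have -> : \prod_i (if i \in J then (l 0 i)%:P else 'X : {poly R}) =
    (\prod_(i in J) l 0 i)%:P * 'X^(n - #|J|).
  rewrite (bigID (mem J)) /=; congr (_ * _).
    by rewrite rmorph_prod; apply: eq_bigr => i ->.
  rewrite (eq_bigr (fun=> 'X)) => [|i /negbTE -> //].
  rewrite prodr_const; congr ('X^_).
  exact: (canRL (addKn #|J|) (etrans (cardC (mem J)) (card_ord n))).
rewrite coefCM coefXn.
have Jn : (#|J| <= n)%N by rewrite -[n in leqRHS]card_ord max_card.
have -> : (n - k == n - #|J|)%N = (#|J| == k).
  by apply/eqP/eqP => [|-> //] e; rewrite -(subKn kn) e subKn.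
by case: eqP => _; rewrite ?mulr1 ?mulr0.
Qed.

(** By Vieta, [esymf k] is a coefficient of the product of the X + l_i, which is up to sign the
    characteristic polynomial at -X. Hence it does not depend on which list of eigenvalues [xget]
    selects. *)
Lemma sigma_char_poly (n k : nat) (A : 'M[R]_n) (l : 'rV[R]_n) : (k <= n)%N ->
  char_poly A = \prod_i ('X - (l 0 i)%:P) -> sigma k A = esymf k l.
Proof.
move=> kn Al; rewrite /sigma -!prod_XaddC_coef //.
have El : char_poly A = \prod_i ('X - (eigenvalues A 0 i)%:P).
  by apply: (@xgetPex _ _ [set l : 'rV[R]_n | char_poly A = \prod_i ('X - (l 0 i)%:P)]); exists l.
have neg (m : 'rV[R]_n) : \prod_i ('X + (m 0 i)%:P) =
    (-1) ^+ n *: ((\prod_i ('X - (m 0 i)%:P)) \Po - 'X).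
  rewrite (eq_bigr (fun i => -1 *: (('X - (m 0 i)%:P) \Po - 'X))) => [|i _].
    by rewrite scaler_prod prodr_const card_ord rmorph_prod.
  by rewrite rmorphB /= comp_polyX comp_polyC scaleN1r opprD !opprK.
by rewrite !neg -El -Al.
Qed.

(** The matrix determinant lemma, by factoring one block matrix in two ways. It is multiplied
    through by [a] because [a] is not invertible in the application, where the entries are
    polynomials and [a] is X - c. *)
Lemma det_scalar_add_rank1 (n : nat) (T : idomainType) (a : T) (x : 'cV[T]_n) (y : 'rV[T]_n) :
  \det (a%:M + x *m y) * a = a ^+ n * (a + (y *m x) 0 0).
Proof.
pose M1 := block_mx (a%:M : 'M[T]_n) x (- y) (1%:M : 'M[T]_1).
have E1 : M1 *m block_mx (1%:M : 'M[T]_n) 0 y (1%:M : 'M[T]_1) =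
    block_mx (a%:M + x *m y) x 0 1%:M.
  by rewrite mulmx_block !mulmx1 !mulmx0 !mul1mx add0r addNr add0r.
have E2 : block_mx (1%:M : 'M[T]_n) 0 y (a%:M : 'M[T]_1) *m M1 =
    block_mx a%:M x 0 (y *m x + a%:M).
  rewrite mulmx_block !mulmx1 !mul1mx !mul0mx !addr0.
  by rewrite mulmxN mul_mx_scalar mul_scalar_mx subrr.
have D1 : \det M1 = \det (a%:M + x *m y).
  have := congr1 determinant E1.
  by rewrite det_mulmx det_lblock det_ublock !det1 !mulr1.
have D2 : a * \det M1 = a ^+ n * (a + (y *m x) 0 0).
  have := congr1 determinant E2.
  rewrite det_mulmx det_lblock det_ublock det1 mul1r !det_scalar expr1 => ->.
  by rewrite [X in _ * \det X]mx11_scalar det_scalar expr1 !mxE eqxx mulr1n addrC.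
by rewrite -D1 mulrC.
Qed.

Definition rank1_pert (n : nat) (c d : R) (x : 'rV[R]_n) : 'M[R]_n :=
  c%:M + d *: (x^T *m x).

Lemma char_poly_rank1_pert (n : nat) (c d : R) (x : 'rV[R]_n.+1) :
  char_poly (rank1_pert c d x) =
  ('X - c%:P) ^+ n * ('X - (c + d * dotp x x)%:P).
Proof.
have X0 : 'X - c%:P != 0 :> {poly R} by rewrite polyXsubC_eq0.
apply: (mulIf X0); rewrite [in RHS]mulrC mulrA -exprS.
rewrite /char_poly; have -> : char_poly_mx (rank1_pert c d x) =
   ('X - c%:P)%:M + map_mx polyC (- d *: x^T) *m map_mx polyC x.
  rewrite /char_poly_mx /rank1_pert -map_mxM /= map_mxD map_scalar_mx /=.
  rewrite opprD addrA [in RHS]raddfB /= -scalemxAl scaleNr map_mxN.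
  by [].
rewrite det_scalar_add_rank1; congr (_ * _).
rewrite -map_mxM mxE -scalemxAr mxE mulNr rmorphN rmorphD /= opprD addrA.
congr (_ - _%:P); congr (_ * _); rewrite mxE /dotp.
by apply: eq_bigr => i _; rewrite mxE.
Qed.

Lemma sigma_rank1_pert (n k : nat) (c d : R) (x : 'rV[R]_n.+1) : (0 < k <= n.+1)%N ->
  sigma k (rank1_pert c d x) =
  'C(n, k)%:R * c ^+ k + 'C(n, k.-1)%:R * (c + d * dotp x x) * c ^+ k.-1.
Proof.
move=> /andP[k0 kn]; set e := c + _.
pose l : 'rV[R]_n.+1 := \row_i (if i == ord0 then e else c).
rewrite (@sigma_char_poly _ _ _ l) //; last first.
  rewrite char_poly_rank1_pert big_ord_recl /= mxE eqxx -/e mulrC; congr (_ * _).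
  rewrite (eq_bigr (fun=> 'X - c%:P)) ?prodr_const ?card_ord // => i _.
  by rewrite mxE.
rewrite -prod_XaddC_coef // big_ord_recl /= mxE eqxx.
rewrite (eq_bigr (fun=> 'X + c%:P)); last by move=> i _; rewrite mxE.
rewrite prodr_const card_ord mulrDl coefD coefXM coefCM.
have H i : (i <= n)%N -> (('X + c%:P) ^+ n)`_(n - i) = 'C(n, i)%:R * c ^+ i.
  move=> i_n; have := @prod_XaddC_coef n i (\row_i c) i_n.
  rewrite (eq_bigr (fun=> 'X + c%:P)) ?prodr_const ?card_ord => [->|j _]; last by rewrite mxE.
  rewrite /esymf (eq_bigr (fun=> c ^+ i)) => [|I /eqP <-].
    rewrite sumr_const mulr_natl; congr (_ *+ _).
    by rewrite -[n in RHS]card_ord -card_draws; apply: eq_card => J; rewrite inE.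
  by rewrite -prodr_const; apply: eq_bigr => j _; rewrite mxE.
case: k k0 kn => [//|k] _ kn /=; rewrite subSS.
rewrite [X in _ + X](_ : _ = 'C(n, k)%:R * e * c ^+ k); last first.
  by rewrite (H k) // mulrCA mulrA.
congr (_ + _); have [nk|nk] := leqP n k.
  rewrite (_ : (n - k = 0)%N) /=; last by apply/eqP; rewrite subn_eq0.
  by rewrite bin_small ?mul0r // ltnS.
have -> : (n - k == 0)%N = false by apply/negbTE; rewrite subn_eq0 -ltnNge.
by rewrite -(H k.+1) // subnS.
Qed.

End Sigma.

(** * Calculus of radial functions *)

Section RadialDerive.
Context {R : realType} {n : nat}.
Implicit Types (x y v : 'rV[R]_n) (i j k l : 'I_n).

Notation e_ i := (delta_mx 0 i : 'rV[R]_n).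
Notation delta i j := ((i == j)%:R : R).

Lemma has_derive_sum (I : Type) (r : seq I) (f : I -> 'rV[R]_n -> R) (d : I -> R) x v :
  (forall a, has_derive x v (f a) (d a)) ->
  has_derive x v (fun y => \sum_(a <- r) f a y) (\sum_(a <- r) d a).
Proof.
move=> fd; elim: r => [|a r IH].
  rewrite big_nil (_ : (fun y => _) = fun=> 0); first exact: has_derive_const.
  by apply/funext => y; rewrite big_nil.
rewrite big_cons (_ : (fun y => _) = (fun y => f a y + \sum_(b <- r) f b y)).
  exact: has_derive_add.
by apply/funext => y; rewrite big_cons.
Qed.

Lemma has_derive_coord i j x : has_derive x (e_ i) (fun y => y 0 j) (delta i j).
Proof.
apply/has_derive_line.
rewrite (_ : (fun h => _) = (fun h : R => delta i j * h + x 0 j)).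
  have := has_derive_add (has_derive_linear (delta i j) 0)
    (has_derive_const (x 0 j) (0 : R) (1 : R)).
  by rewrite addr0.
by apply/funext => h; rewrite !mxE eqxx /= mulrC eq_sym.
Qed.

Lemma has_derive_dotp i x : has_derive x (e_ i) (fun y => dotp y y) (2 * x 0 i).
Proof.
apply: has_derive_eq.
  apply: has_derive_sum => j.
  exact: has_derive_mul (has_derive_coord i j x) (has_derive_coord i j x).
rewrite (bigD1 i) //= eqxx big1 => [|j /negbTE ji]; last by rewrite eq_sym ji mul0r mulr0 addr0.
by rewrite addr0 mul1r mulr1 -mulr2n mulr_natl.
Qed.

Lemma dotp_ge0 x : 0 <= dotp x x.
Proof. by apply: sumr_ge0 => i _; rewrite -expr2 sqr_ge0. Qed.

Lemma sqr_enorm x : enorm x ^+ 2 = dotp x x.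
Proof. by rewrite sqr_sqrtr // dotp_ge0. Qed.

Lemma dotp_eq0 x : dotp x x = 0 -> x = 0.
Proof.
move=> /eqP; rewrite psumr_eq0 => [/allP h|i _]; last by rewrite -expr2 sqr_ge0.
apply/rowP => i; rewrite mxE; apply/eqP.
by have := h i (mem_index_enum i); rewrite /= mulf_eq0 orbb.
Qed.

Lemma continuous_bigsum (I : Type) (r : seq I) (f : I -> 'rV[R]_n -> R) :
  (forall a, continuous (f a)) -> continuous (fun y => \sum_(a <- r) f a y).
Proof.
move=> cf; elim: r => [|a r IH].
  rewrite (_ : (fun y => _) = fun=> 0); first exact: cst_continuous.
  by apply/funext => y; rewrite big_nil.
rewrite (_ : (fun y => _) = (fun y => f a y + \sum_(b <- r) f b y)).
  by move=> x; apply: continuousD; [exact: cf|exact: IH].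
by apply/funext => y; rewrite big_cons.
Qed.

Lemma dotp_continuous : continuous (fun x => dotp x x).
Proof.
by apply: continuous_bigsum => i x; apply: continuousM; exact: coord_continuous.
Qed.

Lemma has_derive_radial (h : R -> R) (d : R) i x :
  has_derive (dotp x x) 1 h d ->
  has_derive x (e_ i) (fun y => h (dotp y y)) (d * (2 * x 0 i)).
Proof.
move=> hd.
exact: (@has_derive_comp_line _ _ h (fun y => dotp y y) _ _ _ _ hd (has_derive_dotp i x)).
Qed.

Lemma has_derive_near (f g : 'rV[R]_n -> R) (O : set 'rV[R]_n) x v d :
  open O -> O x -> (forall y, O y -> f y = g y) -> has_derive x v f d -> has_derive x v g d.
Proof.
move=> oO Ox fg; apply: near_eq_is_derive.
by apply: filterS (open_nbhs_nbhs (conj oO Ox)).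
Qed.

Lemma has_deriveE (f : 'rV[R]_n -> R) i x d : has_derive x (e_ i) f d -> partial i f x = d.
Proof. by move=> [_]. Qed.

End RadialDerive.

(** * The chain rule for functions of the squared radius at the origin *)

Section QuadraticContact.
Context {R : realType}.

Lemma has_derive_quadratic (f : R -> R) (C d : R) : 0 < d ->
  (forall t, `|t| < d -> `|f t - f 0| <= C * t ^+ 2) -> has_derive (0 : R) (1 : R) f 0.
Proof.
move=> d0 H.
have L : (fun h : R => h^-1 *: (f (h *: (1 : R) + 0) - f 0)) @ 0^' --> (0 : R).
  apply/cvgrPdist_le => e e0.
  pose D := Num.min d (e / (`|C| + 1)).
  have C1 : 0 < `|C| + 1 by rewrite ltr_wpDl.
  have D0 : 0 < D by rewrite lt_min d0 divr_gt0.
  exists D => // h /=; rewrite sub0r normrN lt_min => /andP[hd he] h0.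
  rewrite sub0r normrN addr0 normrM normfV [h *: 1]mulr1.
  rewrite mulrC ler_pdivrMr ?normr_gt0 //; apply: le_trans (H h hd) _.
  rewrite -[h ^+ 2]ger0_norm ?sqr_ge0 // normrX expr2 mulrA ler_wpM2r //.
  apply: le_trans (_ : (`|C| + 1) * `|h| <= _).
    by rewrite ler_wpM2r // (le_trans (ler_norm _)) // lerDl.
  by rewrite mulrC -ler_pdivlMr // ltW.
split; first by apply/cvg_ex; exists 0.
exact: cvg_lim L.
Qed.

Lemma has_derive_sqr_contact (f f' : R -> R) : cont_ge0 f -> cont_ge0 f' -> deriv_gt0 f f' ->
  has_derive (0 : R) 1 (fun t => f (t ^+ 2)) 0.
Proof.
move=> cf cf' df.
have [d d0 dP] : exists2 d : R, 0 < d & forall z : R, `|z| < d -> `|f' `|z| | <= `|f' 0| + 1.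
  have /cvgrPdist_le/(_ 1 ltr01) := cf' 0; rewrite normr0 => -[d d0 dP].
  exists d => // z zd; have := dP z; rewrite /= sub0r normrN => /(_ zd) H.
  have -> : f' `|z| = f' 0 - (f' 0 - f' `|z|) by ring.
  by apply: le_trans (ler_normB _ _) _; rewrite lerD2l.
apply: (@has_derive_quadratic _ (`|f' 0| + 1) (Num.min 1 d)); first by rewrite lt_min ltr01.
move=> t; rewrite lt_min => /andP[t1 td].
have td2 : t ^+ 2 < d.
  apply: le_lt_trans td; rewrite -[t ^+ 2]ger0_norm ?sqr_ge0 // normrX expr2.
  by rewrite ler_piMl // ltW.
rewrite expr0n /=.
apply: (@deriv_norm_le R (fun s => f s - f 0) (fun s => (`|f' 0| + 1) * s) f'
  (fun=> `|f' 0| + 1)).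
- by apply: (@Ck_cont _ 0); apply: Ck_sub; [split|exact: Ck_cst].
- by apply: (@Ck_cont _ 0); apply: Ck_mul; [exact: Ck_cst|exact: Ck_id].
- move=> s s0; apply: has_derive_eq (has_derive_sub (df s s0) (has_derive_const _ _ _)) _.
  by rewrite subr0.
- by move=> s s0; exact: has_derive_linear.
- by rewrite subrr.
- by rewrite mulr0.
- exact: sqr_ge0.
- move=> z /andP[z0 zt]; rewrite -{1}(gtr0_norm z0); apply: dP.
  by rewrite (gtr0_norm z0) (lt_trans zt).
Qed.

(* At the origin the chain rule for x |-> f(|x|^2) only needs f to be
   one-sided C^1, since |x|^2 vanishes to second order. *)
Lemma has_derive_radial_ge0 (n : nat) (f f' : R -> R) (i : 'I_n) (x : 'rV[R]_n) :
  cont_ge0 f -> cont_ge0 f' -> deriv_gt0 f f' ->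
  has_derive x (delta_mx 0 i) (fun y => f (dotp y y)) (f' (dotp x x) * (2 * x 0 i)).
Proof.
move=> cf cf' df; have := dotp_ge0 x.
rewrite le_eqVlt => /predU1P[/esym/dotp_eq0 ->|x0]; last first.
  by apply: has_derive_radial; exact: df.
rewrite mxE mulr0 mulr0; apply/has_derive_line.
rewrite (_ : (fun h => _) = (fun t : R => f (t ^+ 2))); first exact: has_derive_sqr_contact cf' df.
apply/funext => t; congr (f _); rewrite /dotp (bigD1 i) //= big1 => [|j /negbTE ji].
  by rewrite !mxE !eqxx /= mulr1 !addr0 expr2.
by rewrite !mxE ji andbF mulr0 addr0 mul0r.
Qed.

End QuadraticContact.

(** * From one-sided smoothness in the squared radius to smoothness on the whole space *)

Section SmoothRadial.
Context {R : realType} {n : nat}.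
Implicit Types (f g : 'rV[R]_n -> R).

Fixpoint CN (j : nat) f : Prop :=
  continuous f /\ if j is j'.+1 then
    exists2 df : 'I_n -> 'rV[R]_n -> R,
      forall i x, has_derive x (delta_mx 0 i) f (df i x) & forall i, CN j' (df i)
  else True.

Lemma CN_continuous j f : CN j f -> continuous f.
Proof. by case: j => [|j] []. Qed.

Lemma CNW j f : CN j.+1 f -> CN j f.
Proof.
elim: j f => [|j IH] f [cf [df fd Cd]]; first by split.
by split=> //; exists df => // i; exact: IH.
Qed.

Lemma CN_cst j (c : R) : CN j (fun=> c).
Proof.
elim: j c => [|j IH] c; split=> //; try exact: cst_continuous.
by exists (fun _ _ => 0) => // i x; exact: has_derive_const.
Qed.

Lemma CN_coord j i : CN j (fun x => x 0 i).
Proof.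
case: j => [|j]; split=> //; try exact: coord_continuous.
by exists (fun l _ => (l == i)%:R) => [l x|l]; [exact: has_derive_coord|exact: CN_cst].
Qed.

Lemma CN_add j f g : CN j f -> CN j g -> CN j (fun x => f x + g x).
Proof.
elim: j f g => [|j IH] f g [cf Hf] [cg Hg]; split=> //;
  try (by move=> x; apply: continuousD; [exact: cf|exact: cg]).
case: Hf Hg => df fd Cf [dg gd Cg].
exists (fun i x => df i x + dg i x) => [i x|i].
  exact: has_derive_add (fd i x) (gd i x).
exact: IH (Cf i) (Cg i).
Qed.

Lemma CN_mul j f g : CN j f -> CN j g -> CN j (fun x => f x * g x).
Proof.
elim: j f g => [|j IH] f g Cf Cg; (split; first
  (by move=> x; apply: continuousM; [exact: (CN_continuous Cf)|exact: (CN_continuous Cg)])) => //.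
have [Cf1 Cg1] := (CNW Cf, CNW Cg).
case: Cf Cg => _ [df fd Cf] [_ [dg gd Cg]].
exists (fun i x => df i x * g x + f x * dg i x) => [i x|i].
  exact: has_derive_mul (fd i x) (gd i x).
by apply: CN_add; [exact: IH (Cf i) Cg1|exact: IH Cf1 (Cg i)].
Qed.

Lemma CN_radial j (h : R -> R) : Ck j.+1 h -> CN j (fun x => h (dotp x x)).
Proof.
elim: j h => [|j IH] h Ch; (split; first
  (move=> x; have := continuous_compose (@dotp_continuous R n x) (@Ck_cont R _ _ Ch (dotp x x));
   by rewrite (_ : (fun y => _) = (fun y => h (dotp y y))) //;
   apply/funext => y; rewrite ger0_norm // dotp_ge0)) => //.
case: (Ch) => ch [h' hd Ch'].
exists (fun i x => h' (dotp x x) * (2 * x 0 i)) => [i x|i].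
  by apply: has_derive_radial_ge0 => //; case: Ch'.
by apply: CN_mul; [exact: IH|apply: CN_mul; [exact: CN_cst|exact: CN_coord]].
Qed.

Lemma CN_smooth f : (forall j, CN j f) -> smooth f.
Proof.
move=> Cf s.
have Cs j : CN j (iter_partial s f).
  elim: s j => [|i s IH] j //=.
  case: (IH j.+1) => _ [df fd Cd].
  have -> : partial i (iter_partial s f) = df i by apply/funext => x; exact: has_deriveE.
  exact: Cd.
split; first exact: (CN_continuous (Cs 0%N)).
by move=> i x; case: (Cs 1%N) => _ [df fd _]; case: (fd i x).
Qed.

Lemma smooth_radial (h : R -> R) : (forall j, Ck j h) ->
  smooth (fun x : 'rV[R]_n => h (dotp x x)).
Proof. by move=> Ch; apply: CN_smooth => j; exact: CN_radial. Qed.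

End SmoothRadial.

(** * Curvature of a conformally flat radial metric *)

Section ConformallyFlat.
Context {R : realType} {n : nat}.
(** For the constructed solution [O] is the whole space. For a hypothetical solution it is the
    complement of the origin, because its profile is there shown to be differentiable only for s >
    0. *)
Variables (O : set 'rV[R]_n) (V V1 V2 : R -> R).
Hypothesis oO : open O.
Implicit Types (x y : 'rV[R]_n) (i j k l : 'I_n).

Let sq x := dotp x x.
Hypothesis V_gt0 : forall x, O x -> 0 < V (sq x).
Hypothesis dV : forall x i, O x ->
  has_derive x (delta_mx 0 i) (fun y => V (sq y)) (V1 (sq x) * (2 * x 0 i)).
Hypothesis dV1 : forall x i, O x ->
  has_derive x (delta_mx 0 i) (fun y => V1 (sq y)) (V2 (sq x) * (2 * x 0 i)).

Notation delta i j := ((i == j)%:R : R).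

Lemma partial_radial (v : 'rV[R]_n -> R) i x : (forall y, O y -> v y = V (sq y)) ->
  O x -> partial i v x = 2 * V1 (sq x) * x 0 i.
Proof.
move=> vE Ox; rewrite (@has_deriveE _ _ _ _ _ (V1 (sq x) * (2 * x 0 i))); first by ring.
by apply: has_derive_near oO Ox _ (dV i Ox) => y Oy; rewrite vE.
Qed.

Lemma grad_radial (v : 'rV[R]_n -> R) x : (forall y, O y -> v y = V (sq y)) ->
  O x -> grad v x = (2 * V1 (sq x)) *: x.
Proof. by move=> vE Ox; apply/rowP => i; rewrite !mxE partial_radial. Qed.

Lemma hessian_radial (v : 'rV[R]_n -> R) x : (forall y, O y -> v y = V (sq y)) ->
  O x -> hessian v x = rank1_pert (2 * V1 (sq x)) (4 * V2 (sq x)) x.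
Proof.
move=> vE Ox; apply/matrixP => i j; rewrite !mxE big_ord1 !mxE.
apply: has_deriveE.
apply: (has_derive_near oO Ox (f := fun y => 2 * V1 (sq y) * y 0 j)).
  by move=> y Oy; rewrite partial_radial.
apply: has_derive_eq.
  exact: has_derive_mul (has_derive_mul (has_derive_const 2 _ _) (dV1 i Ox))
    (has_derive_coord i j x).
by rewrite -mulr_natr; ring.
Qed.

Definition angular x := 2 * V1 (sq x) - 2 * sq x * V1 (sq x) ^+ 2 / V (sq x).

Lemma equation_matrix_radial (v : 'rV[R]_n -> R) x : (forall y, O y -> v y = V (sq y)) ->
  O x -> hessian v x - ((V (sq x))^-1 / 2 * enorm (grad v x) ^+ 2)%:M =
         rank1_pert (angular x) (4 * V2 (sq x)) x.
Proof.
move=> vE Ox; rewrite hessian_radial // grad_radial // sqr_enorm.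
rewrite /rank1_pert addrAC -raddfB /=; congr (_%:M + _).
rewrite /angular; congr (_ - _).
have -> : dotp ((2 * V1 (sq x)) *: x) ((2 * V1 (sq x)) *: x) = (2 * V1 (sq x)) ^+ 2 * sq x.
  by rewrite /sq /dotp mulr_sumr; apply: eq_bigr => i _; rewrite !mxE; ring.
by have := V_gt0 Ox; move: (V _) => w w0; field; rewrite gt_eqF.
Qed.

Variable g : 'rV[R]_n -> 'M[R]_n.
Hypothesis gE : forall x, O x -> g x = ((V (sq x)) ^- 2)%:M.

(** Write g = e^(2f) |dx|^2 with f = -ln V. Then Df = p x, [p1] is the derivative of [p] in s, and p
    T is the usual expression for the Christoffel symbols of a conformally flat metric. *)
Let p x := - 2 * V1 (sq x) / V (sq x).
Let p1 x := - 2 * V2 (sq x) / V (sq x) + 2 * V1 (sq x) ^+ 2 / V (sq x) ^+ 2.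
Let T k i j x := x 0 i * delta j k + x 0 j * delta i k - x 0 k * delta i j.

Let dg i j l x : O x ->
  partial i (fun y => g y j l) x = - 4 * V1 (sq x) / V (sq x) ^+ 3 * x 0 i * delta j l.
Proof.
move=> Ox; apply: has_deriveE.
apply: (has_derive_near oO Ox (f := fun y => (V (sq y) ^+ 2)^-1 * delta j l)).
  by move=> y Oy; rewrite gE // mxE mulr_natr.
have V0 := V_gt0 Ox.
apply: has_derive_eq.
  apply: has_derive_mul (has_derive_const (delta j l) _ _).
  by apply: has_derive_inv (has_derive_exp 2 (dV i Ox)); rewrite expf_neq0 // gt_eqF.
by rewrite /= mulr0 addr0; move: (V _) V0 => w w0; field; rewrite gt_eqF.
Qed.

Let sum_delta (F : 'I_n -> R) i : \sum_k delta i k * F k = F i.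
Proof.
rewrite (bigD1 i) //= eqxx mul1r big1 ?addr0 // => k.
by rewrite eq_sym => /negbTE ->; rewrite mul0r.
Qed.

Let invg x : O x -> invmx (g x) = (V (sq x) ^+ 2)%:M.
Proof. by move=> Ox; rewrite gE // invmx_scalar invrK. Qed.

Lemma christoffel_conformal k i j x : O x -> christoffel g k i j x = p x * T k i j x.
Proof.
move=> Ox; rewrite /christoffel invg //.
pose c := - 4 * V1 (sq x) / V (sq x) ^+ 3.
rewrite (eq_bigr (fun l => delta k l * (V (sq x) ^+ 2 *
  (c * x 0 i * delta j l + c * x 0 j * delta i l - c * x 0 l * delta i j)))); last first.
  by move=> l _; rewrite mxE !dg // mulrA mulr_natl.
rewrite sum_delta /c /p /T; have := V_gt0 Ox; move: (V _) => w w0.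
by field; rewrite gt_eqF.
Qed.

Let dT k i j l x := delta l i * delta j k + delta l j * delta i k - delta l k * delta i j.

Let d_christoffel k i j l x : O x -> partial l (christoffel g k i j) x =
  2 * p1 x * x 0 l * T k i j x + p x * dT k i j l x.
Proof.
move=> Ox; apply: has_deriveE; have V0 := V_gt0 Ox.
apply: (has_derive_near oO Ox (f := fun y => p y * T k i j y)).
  by move=> y Oy; rewrite christoffel_conformal.
have dp : has_derive x (delta_mx 0 l) p (2 * p1 x * x 0 l).
  have H := has_derive_mul (has_derive_mul (has_derive_const (- 2) x (delta_mx 0 l)) (dV1 l Ox))
    (has_derive_inv (lt0r_neq0 V0) (dV l Ox)).
  apply: has_derive_eq H _; rewrite /p1.
  by move: (V _) V0 => w w0; field; rewrite gt_eqF.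
apply: has_derive_mul dp _.
have C a b : has_derive x (delta_mx 0 l) (fun y => y 0 a * b) (delta l a * b).
  apply: has_derive_eq (has_derive_mul (has_derive_coord l a x) (has_derive_const b _ _)) _.
  by rewrite mulr0 addr0.
exact: has_derive_sub (has_derive_add (C _ _) (C _ _)) (C _ _).
Qed.

Let T_diag k i x : T k i k x = x 0 i.
Proof. by rewrite /T eqxx mulr1 addrK. Qed.

Let T_diag' k l x : T k k l x = x 0 l.
Proof. by rewrite /T eqxx (eq_sym l k) mulr1; ring. Qed.

Let sum_sq x : \sum_l x 0 l * x 0 l = sq x. Proof. by []. Qed.

Let sum_xT i j x : \sum_l x 0 l * T l i j x = 2 * x 0 i * x 0 j - sq x * delta i j.
Proof.
rewrite (eq_bigr (fun l => delta j l * (x 0 l * x 0 i) +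
  delta i l * (x 0 l * x 0 j) - x 0 l * x 0 l * delta i j)); last first.
  by move=> l _; rewrite /T; ring.
by rewrite sumrB big_split /= !sum_delta -mulr_suml sum_sq; ring.
Qed.

Let sum_dT i j x : \sum_k dT k i j k x = (2 - n%:R) * delta i j.
Proof.
rewrite (eq_bigr (fun k => delta i k * delta j k + delta j k * delta i k - delta i j)); last first.
  by move=> k _; rewrite /dT eqxx (eq_sym k i) (eq_sym k j) mul1r.
rewrite sumrB big_split /= !sum_delta sumr_const card_ord -mulr_natl (eq_sym j i).
by ring.
Qed.

Let sum_dT' i j x : \sum_k dT k i k j x = n%:R * delta i j.
Proof.
rewrite (eq_bigr (fun k => delta i j)); last first.
  by move=> k _; rewrite /dT eqxx (eq_sym j i) mulr1 addrK.
by rewrite sumr_const card_ord mulr_natl.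
Qed.

Let sum_TT i j x : \sum_k \sum_l T k j l x * T l i k x =
  (n%:R + 2) * x 0 i * x 0 j - 2 * sq x * delta i j.
Proof.
have inner k : \sum_l T k j l x * T l i k x =
    x 0 j * x 0 i + delta j k * (2 * x 0 i * x 0 k - sq x * delta i k) - x 0 k * T j i k x.
  rewrite (eq_bigr (fun l => x 0 j * (delta k l * T l i k x) + delta j k * (x 0 l * T l i k x) -
      x 0 k * (delta j l * T l i k x))); last first.
    by move=> l _; rewrite {1}/T (eq_sym l k); ring.
  by rewrite sumrB big_split /= -!mulr_sumr !sum_delta T_diag sum_xT.
under eq_bigr => k _ do rewrite inner.
rewrite sumrB big_split /= sum_delta sumr_const card_ord -mulr_natl.
rewrite [X in _ - X](eq_bigr (fun k => delta j k * (x 0 k * x 0 i) +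
  delta i j * (x 0 k * x 0 k) - delta i k * (x 0 k * x 0 j))); last first.
  by move=> k _; rewrite /T (eq_sym k j); ring.
by rewrite sumrB big_split /= !sum_delta -mulr_sumr sum_sq; ring.
Qed.

(** With f = -ln V this is the conformal change formula Ric = -(n - 2)(D^2 f - df df) - (Laplacian f
    + (n - 2)|Df|^2) I, where D^2 f = p I + 2 p1 x x^T. *)
Lemma ricci_conformal i j x : O x -> ricci g x i j =
  ((2 - 2 * n%:R) * p x - 2 * p1 x * sq x - (n%:R - 2) * p x ^+ 2 * sq x) * delta i j
  + (n%:R - 2) * (p x ^+ 2 - 2 * p1 x) * (x 0 i * x 0 j).
Proof.
move=> Ox; rewrite mxE.
have -> : \sum_k (partial k (christoffel g k i j) x - partial j (christoffel g k i k) x) =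
    2 * p1 x * (2 * x 0 i * x 0 j - sq x * delta i j) + p x * ((2 - n%:R) * delta i j) -
    (n%:R * (2 * p1 x * x 0 j * x 0 i) + p x * (n%:R * delta i j)).
  rewrite (eq_bigr (fun k => 2 * p1 x * (x 0 k * T k i j x) + p x * dT k i j k x -
    (2 * p1 x * x 0 j * x 0 i + p x * dT k i k j x))); last first.
    by move=> k _; rewrite !d_christoffel // T_diag; ring.
  rewrite sumrB !big_split /= -!mulr_sumr sum_xT sum_dT sum_dT' sumr_const card_ord.
  by ring.
have -> : \sum_k \sum_l (christoffel g k k l x * christoffel g l i j x -
      christoffel g k j l x * christoffel g l i k x) =
    n%:R * (p x ^+ 2 * (2 * x 0 i * x 0 j - sq x * delta i j)) -
    p x ^+ 2 * ((n%:R + 2) * x 0 i * x 0 j - 2 * sq x * delta i j).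
  rewrite (eq_bigr (fun k => p x ^+ 2 * (\sum_l x 0 l * T l i j x) -
    p x ^+ 2 * (\sum_l T k j l x * T l i k x))); last first.
    move=> k _; rewrite !mulr_sumr -sumrB; apply: eq_bigr => l _.
    by rewrite !christoffel_conformal // T_diag'; ring.
  by rewrite sumrB -!mulr_sumr sum_TT sumr_const card_ord sum_xT; ring.
by ring.
Qed.

(** The Schouten tensor is -D^2 f + df df - |Df|^2/2 I. For f = -ln V the quadratic terms in V1
    along x x^T cancel, leaving V2 alone there; raising an index multiplies by V^2. *)
Lemma schouten_conformal x : (3 <= n)%N -> O x ->
  invmx (g x) *m schouten g x =
  rank1_pert (V (sq x) * angular x) (V (sq x) * (4 * V2 (sq x))) x.
Proof.
move=> n3 Ox; have V0 := V_gt0 Ox.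
have n2 : (n%:R - 2 : R) != 0 by rewrite subr_eq0 eqr_nat; case: n n3 => [|[|[]]].
have n1 : (n%:R - 1 : R) != 0 by rewrite subr_eq0 (eqr_nat R n 1); case: n n3 => [|[|[]]].
have RE : scalar_curvature g x = V (sq x) ^+ 2 *
   (n%:R * ((2 - 2 * n%:R) * p x - 2 * p1 x * sq x - (n%:R - 2) * p x ^+ 2 * sq x) +
    (n%:R - 2) * (p x ^+ 2 - 2 * p1 x) * sq x).
  rewrite /scalar_curvature invg // mul_scalar_mx mxtraceZ; congr (_ * _).
  rewrite /mxtrace (eq_bigr (fun i =>
    ((2 - 2 * n%:R) * p x - 2 * p1 x * sq x - (n%:R - 2) * p x ^+ 2 * sq x)
    + (n%:R - 2) * (p x ^+ 2 - 2 * p1 x) * (x 0 i * x 0 i))).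
    by rewrite big_split /= -mulr_sumr sum_sq sumr_const card_ord; ring.
  by move=> i _; rewrite ricci_conformal // eqxx mulr1.
have SE i j : schouten g x i j = (p x ^+ 2 - 2 * p1 x) * (x 0 i * x 0 j) -
    (p x + p x ^+ 2 * sq x / 2) * delta i j.
  have RmE := ricci_conformal i j Ox.
  rewrite /schouten RE gE //; move: (ricci g x) RmE => Rm RmE.
  rewrite 3!mxE RmE 2!mxE -[V (sq x) ^- 2 *+ (i == j)]mulr_natr.
  apply: (mulfI n2); rewrite mulVKf //.
  move: (p x) (p1 x) (sq x) (x 0 i) (x 0 j) (delta i j) (V (sq x)) V0 => a b c d e f w w0.
  by field; rewrite (gt_eqF w0) n1.
rewrite invg // mul_scalar_mx; apply/matrixP => i j.
rewrite mxE SE !mxE big_ord1 !mxE /angular -[V (sq x) * _ *+ (i == j)]mulr_natr /p /p1.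
move: (V _) V0 => w w0.
by field; rewrite gt_eqF.
Qed.

End ConformallyFlat.

(** * The equation in radial form *)

Section SigmaValue.
Context {R : realType}.

(* sigma_j of the list (e, b, ..., b) with n copies of b. *)
Definition sigma_pair (n j : nat) (b e : R) : R :=
  'C(n, j)%:R * b ^+ j + 'C(n, j.-1)%:R * e * b ^+ j.-1.

(** The relation j C(n,j) = (n - j + 1) C(n,j-1) lets a power of b be factored out, so for b > 0 the
    sign of sigma_j is that of an expression linear in b and e. *)
Lemma sigma_pairE (n j : nat) (b e : R) : (0 < j <= n.+1)%N ->
  j%:R * sigma_pair n j b e =
  'C(n, j.-1)%:R * b ^+ j.-1 * ((n.+1%:R - j%:R) * b + j%:R * e).
Proof.
case: j => [//|j] /= jn; rewrite /sigma_pair /= mulrDr mulrA -natrM mul_bin_left.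
by rewrite natrM natrB // exprS -!natr1; ring.
Qed.

Lemma sigma_pair_gt0 (n j : nat) (b e : R) : (0 < j <= n.+1)%N -> 0 < b ->
  (0 < sigma_pair n j b e) = (0 < (n.+1%:R - j%:R) * b + j%:R * e).
Proof.
move=> jn b0; have j0 : 0 < j%:R :> R by rewrite ltr0n; case/andP: jn.
rewrite -(pmulr_rgt0 _ j0) sigma_pairE // pmulr_rgt0 //.
rewrite mulr_gt0 ?exprn_gt0 // ltr0n bin_gt0.
by case: j jn {j0} => [//|j] /= ; rewrite ltnS.
Qed.

(** Here sigma_1 = n b + e and sigma_2 = n b ((n-1)/2 b + e). If b <= 0, the last bracket is sigma_1
    - (n+1)/2 b > 0, which forces sigma_2 <= 0. *)
Lemma sigma_pair_pos (n : nat) (b e : R) : (0 < n)%N ->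
  0 < sigma_pair n 1 b e -> 0 < sigma_pair n 2 b e -> 0 < b.
Proof.
move=> n0; rewrite /sigma_pair /= bin0 bin1 expr1 expr0 mul1r mulr1 => s1.
have n0' : 1 <= n%:R :> R by rewrite ler1n.
have -> : 'C(n, 2)%:R * b ^+ 2 + n%:R * e * b = (n%:R * b) * ((n%:R - 1) / 2 * b + e).
  have E : 2 * 'C(n, 2)%:R = n%:R * (n%:R - 1) :> R.
    rewrite -natrM -(natrB _ n0) -natrM; congr _%:R.
    by rewrite (mul_bin_left n 1) bin1 mulnC.
  have -> : 'C(n, 2)%:R = n%:R * (n%:R - 1) / 2 :> R by rewrite -E mulrC mulKf.
  by field.
rewrite !ltNge; apply: contraNN => b0.
have nb : n%:R * b <= 0 by rewrite mulr_ge0_le0 // (le_trans ler01).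
have h : 0 <= (n%:R - 1) / 2 * b + e.
  have : (n%:R + 1) / 2 * b <= 0.
    by rewrite mulr_ge0_le0 // divr_ge0 // addr_ge0 // (le_trans ler01).
  move: s1; nra.
by rewrite mulr_le0_ge0.
Qed.

End SigmaValue.

Section LocalEquation.
Context {R : realType} {n' : nat}.
Let n := n'.+1.
Variables (k : nat) (q : R) (O : set 'rV[R]_n) (V V1 V2 : R -> R) (u : 'rV[R]_n -> R).
Hypotheses (n3 : (3 <= n)%N) (oO : open O) (qp : 0 < q).
Hypothesis dV : forall x (i : 'I_n), O x ->
  has_derive x (delta_mx 0 i) (fun y => V (dotp y y)) (V1 (dotp x x) * (2 * x 0 i)).
Hypothesis dV1 : forall x (i : 'I_n), O x ->
  has_derive x (delta_mx 0 i) (fun y => V1 (dotp y y)) (V2 (dotp x x) * (2 * x 0 i)).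
Hypotheses (u_gt0 : forall x, 0 < u x) (uV : forall x, O x -> u x `^ (- q) = V (dotp x x)).

Let q0 : q != 0. Proof. exact: lt0r_neq0. Qed.
Let V_gt0 x : O x -> 0 < V (dotp x x).
Proof. by move=> Ox; rewrite -uV // powR_gt0. Qed.

Definition tangential (s : R) := 2 * V1 s - 2 * s * V1 s ^+ 2 / V s.
Definition radial (s : R) := tangential s + 4 * V2 s * s.

Lemma sigma_metric_radial (j : nat) x : (0 < j <= n)%N -> O x ->
  q = 2 * k%:R / (n%:R + 2 * k%:R) ->
  sigma_metric (conf_metric k u) j x =
  V (dotp x x) ^+ j * sigma_pair n' j (tangential (dotp x x)) (radial (dotp x x)).
Proof.
move=> jn Ox qE; rewrite /sigma_metric.
rewrite (schouten_conformal oO V_gt0 dV dV1 (g := conf_metric k u)) //; last first.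
  move=> y Oy; rewrite /conf_metric; congr (_%:M).
  rewrite -uV // -powR_mulrn ?powR_ge0 // -powRN -powRrM; congr (_ `^ _).
  by rewrite qE; field; rewrite gt_eqF // ltr_wpDr ?mulr_ge0 // ltr0n.
rewrite sigma_rank1_pert //; case: j jn => [//|j] jn.
rewrite /sigma_pair /radial /angular -/(tangential _) /= !exprMn exprS.
by ring.
Qed.

Lemma sigma_equation_radial x : (0 < k <= n)%N -> O x ->
  sigma k (hessian (fun y => u y `^ (- q)) x -
    (u x `^ q / 2 * enorm (grad (fun y => u y `^ (- q)) x) ^+ 2)%:M) =
  sigma_pair n' k (tangential (dotp x x)) (radial (dotp x x)).
Proof.
move=> kn Ox.
rewrite (_ : u x `^ q = (V (dotp x x))^-1); last by rewrite -uV // powRN invrK.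
by rewrite (equation_matrix_radial oO V_gt0 dV dV1) // sigma_rank1_pert.
Qed.

Lemma grad_source_radial x : O x -> u x = V (dotp x x) `^ (- q^-1) ->
  (forall y, O y -> u y = V (dotp y y) `^ (- q^-1)) ->
  dotp x (grad u x) = - (2 / q) * dotp x x * u x * V1 (dotp x x) / V (dotp x x).
Proof.
move=> Ox ux uy; have V0 := V_gt0 Ox.
have E i : partial i u x = - (2 / q) * u x * V1 (dotp x x) / V (dotp x x) * x 0 i.
  apply: has_deriveE.
  apply: (has_derive_near oO Ox (f := fun y => V (dotp y y) `^ (- q^-1))).
    by move=> y Oy; rewrite uy.
  apply: has_derive_eq.
    exact: (has_derive_comp_line (has_derive_powR _ V0) (dV i Ox)).
  rewrite powRB ?(gt_eqF V0) ?implybT // powRr1 ?(ltW V0) // -ux.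
  by field; rewrite q0 gt_eqF.
rewrite /dotp; under eq_bigr => i _ do rewrite mxE E mulrCA.
rewrite -mulr_sumr -/(dotp x x); ring.
Qed.

Lemma source_radial (theta rho : R) x : O x ->
  u x `^ (q - 1) * ((2 * theta + rho) * u x + 2 * theta * q * dotp x (grad u x)) =
  ((2 * theta + rho) - 4 * theta * (dotp x x * V1 (dotp x x) / V (dotp x x))) / V (dotp x x).
Proof.
move=> Ox; have V0 := V_gt0 Ox; have u0 := u_gt0 x.
have uE y : O y -> u y = V (dotp y y) `^ (- q^-1).
  by move=> Oy; rewrite -uV // -powRrM mulrNN divff // powRr1 // ltW.
rewrite grad_source_radial //; last exact: uE.
have uq : u x `^ (q - 1) * u x = (V (dotp x x))^-1.
  by rewrite -uV // powRN invrK mulrC mulr_powRB1 // ltW.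
rewrite [RHS]mulrC -uq.
by field.
Qed.

End LocalEquation.

(** * Logarithmic growth incompatible with an upper bound below 2 *)

Section Nonexistence.
Context {R : realType}.

Lemma deriv_pos_nondecreasing (f f' : R -> R) (x y : R) : deriv_gt0 f f' ->
  0 < x -> x <= y -> (forall z, x < z < y -> 0 <= f' z) -> f x <= f y.
Proof.
move=> df x0 xy f'0.
have H z : z \in `[x, y] -> 0 < z.
  by rewrite in_itv /= => /andP[xz _]; exact: lt_le_trans xz.
apply: (@ger0_derive1_le_cc _ f x y) => //.
- by move=> z /subset_itv_oo_cc/H z0; case: (df z z0).
- move=> z zxy; have z0 := H z (subset_itv_oo_cc zxy).
  rewrite derive1E; case: (df z z0) => _ ->.
  by apply: f'0; move: zxy; rewrite in_itv.
- by apply: derivable_within_continuous => z /H z0; case: (df z z0).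
- by rewrite in_itv /= lexx xy.
- by rewrite in_itv /= lexx xy.
Qed.

(* y = 2 s V'/V is increasing at a definite logarithmic rate as long as it
   stays in a compact part of (0, 2), so it cannot stay below kap < 2. *)
Lemma no_global_profile (V V1 V2 : R -> R) (gam kap : R) :
  gam < 1 -> kap < 2 ->
  deriv_gt0 V V1 -> deriv_gt0 V1 V2 ->
  (forall s, 0 < s -> [/\ 0 < V s, 0 < tangential V V1 s,
     0 < gam * tangential V V1 s + 2 * s * V2 s &
     2 * s * V1 s / V s < kap]) -> False.
Proof.
move=> g1 k2 dV dV1 H.
pose y s := 2 * s * V1 s / V s.
pose y' s := 2 * V1 s / V s + 2 * s * V2 s / V s - 2 * s * V1 s ^+ 2 / V s ^+ 2.
have dy : deriv_gt0 y y'.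
  move=> s s0; have [V0 _ _ _] := H s s0.
  have D := has_derive_mul (has_derive_mul (has_derive_linear 2 s) (dV1 s s0))
    (has_derive_inv (lt0r_neq0 V0) (dV s s0)).
  by apply: has_derive_eq D _; rewrite /y'; field; rewrite gt_eqF.
have ty s : 0 < s -> s * tangential V V1 s / V s = y s * (1 - y s / 2).
  by move=> s0; have [V0 _ _ _] := H s s0; rewrite /tangential /y; field; rewrite gt_eqF.
have y02 s : 0 < s -> 0 < y s.
  move=> s0; have [V0 t0 _ yk] := H s s0.
  have : 0 < y s * (1 - y s / 2) by rewrite -ty // divr_gt0 // mulr_gt0.
  by rewrite pmulr_lgt0 // subr_gt0 ltr_pdivrMr // mul1r (lt_trans yk).
have sy' s : 0 < s -> (1 - gam) * (y s * (1 - y s / 2)) <= s * y' s.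
  move=> s0; have [V0 t0 h _] := H s s0; rewrite -ty // -subr_ge0.
  have -> : s * y' s - (1 - gam) * (s * tangential V V1 s / V s) =
      s / V s * (gam * tangential V V1 s + 2 * s * V2 s).
    by rewrite /y' /tangential; field; rewrite gt_eqF.
  by rewrite ltW // mulr_gt0 // divr_gt0.
have y'0 s : 0 < s -> 0 <= y' s.
  move=> s0; have [V0 t0 _ _] := H s s0.
  rewrite -(pmulr_rge0 _ s0); apply: le_trans (sy' s s0).
  by rewrite -ty // mulr_ge0 // ?subr_ge0 ?ltW // divr_gt0 // mulr_gt0.
have y1 := y02 1 ltr01.
(* A lower bound for s y' on s >= 1: there y lies between y(1) and kap, so y (1 - y/2) is at least
   y(1) (1 - kap/2). *)
pose d := (1 - gam) * (y 1 * (1 - kap / 2)).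
have d0 : 0 < d by rewrite /d mulr_gt0 ?subr_gt0 // mulr_gt0 // subr_gt0 ltr_pdivrMr // mul1r.
have sy s : 1 <= s -> y 1 <= y s.
  move=> s1; apply: (deriv_pos_nondecreasing dy) => // z /andP[z1 _].
  by apply: y'0; exact: lt_trans z1.
have F s : 1 <= s -> y 1 <= y s - d * ln s.
  move=> s1; have -> : y 1 = y 1 - d * ln 1 by rewrite ln1 mulr0 subr0.
  apply: (@deriv_pos_nondecreasing (fun s => y s - d * ln s) (fun s => y' s - d * s^-1)) => //.
    move=> z z0; apply: has_derive_sub (dy z z0) _.
    have Dl : has_derive z 1 (@ln R) z^-1 by exact: is_derive1_ln.
    by apply: has_derive_eq (has_derive_mul (has_derive_const d z 1) Dl) _; rewrite mul0r add0r.
  move=> z /andP[z1 _]; have z0 : 0 < z by exact: lt_trans z1.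
  rewrite subr_ge0 -(ler_pM2l z0) mulrCA divff ?gt_eqF // mulr1.
  apply: le_trans (sy' z z0); rewrite /d ler_pM2l ?subr_gt0 //.
  have [V0 _ _ yk] := H z z0.
  apply: ler_pM; [exact: ltW|lra|exact: sy (ltW z1)|].
  by rewrite lerD2l lerN2 ler_pM2r // ltW.
(* At s = e^(2/d) the logarithmic term equals 2, so y >= y(1) + 2 > 2, against y < kap < 2. *)
have e1 : 1 <= expR (2 / d) by rewrite -expR0 ler_expR divr_ge0 // ltW.
have := F _ e1; rewrite expRK mulrCA divff ?gt_eqF // mulr1.
have [_ _ _] := H (expR (2 / d)) (expR_gt0 _); rewrite -/(y _); lra.
Qed.

End Nonexistence.

(** * Nonexistence *)

Section PartOne.
Context {R : realType} {n' : nat}.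
Let n := n'.+1.

Lemma has_derive_scale (f : 'rV[R]_n -> R) (v : 'rV[R]_n) (t d : R) :
  has_derive (t *: v) v f d -> has_derive t 1 (fun t => f (t *: v)) d.
Proof.
move=> /has_derive_line fd; apply/has_derive_line.
rewrite (_ : (fun h => _) = (fun h : R => f (h *: v + t *: v))) //.
by apply/funext => h; rewrite [h *: 1]mulr1 scalerDl.
Qed.

Lemma derivable_has_derive (V : normedModType R) (f : V -> R) (x v : V) :
  derivable f x v -> has_derive x v f ('D_v f x).
Proof. exact: derivableP. Qed.

Variables (k : nat) (theta rho : R).
Hypotheses (n3 : (3 <= n)%N) (kn : (0 < k <= n)%N) (n2k : (n < 2 * k)%N).
Hypotheses (theta0 : 0 < theta).

Let q : R := 2 * k%:R / (n%:R + 2 * k%:R).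
Let k0 : 0 < k%:R :> R. Proof. by rewrite ltr0n; case/andP: kn. Qed.
Let N0 : 0 < n%:R + 2 * k%:R :> R.
Proof. by rewrite ltr_wpDr ?mulr_ge0 // ltr0n. Qed.
Let q0 : 0 < q. Proof. by rewrite divr_gt0 // mulr_gt0. Qed.

Lemma nonexistence : rho < 2 * theta ->
  ~ exists u : 'rV[R]_n -> R, admissible_solution k theta rho u.
Proof.
move=> rho_lt [u [u0 su ru eq_u adm]].
pose e : 'rV[R]_n := delta_mx 0 ord0.
have enorm_e (t : R) : 0 <= t -> enorm (t *: e) = t.
  move=> t0; rewrite /enorm -[RHS](ger0_norm t0) -sqrtr_sqr; congr (Num.sqrt _).
  rewrite /dotp (bigD1 ord0) //= big1 => [|i /negbTE i0].
    by rewrite !mxE eqxx addr0 mulr1.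
  by rewrite !mxE i0 !mulr0.
(* The profile is taken along one coordinate ray. The square root makes it differentiable for s > 0
   only, which is enough since the contradiction comes from large s. *)
pose U (s : R) := u (Num.sqrt s *: e).
pose phi1 (t : R) := partial ord0 u (t *: e).
pose U1 (s : R) := phi1 (Num.sqrt s) * (2 * Num.sqrt s)^-1.
pose V s := U s `^ (- q).
pose V1 s := - q * U s `^ (- q - 1) * U1 s.
have dsqrt (s : R) : 0 < s -> has_derive s 1 (@Num.sqrt R) (2 * Num.sqrt s)^-1.
  by move=> s0; exact: is_derive1_sqrt.
have dphi (t : R) : has_derive t 1 (fun t => u (t *: e)) (phi1 t).
  by apply: has_derive_scale; apply: derivable_has_derive; case: (su [::]) => _; exact.
have dphi1 (t : R) : exists d, has_derive t 1 phi1 d.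
  exists ('D_e (partial ord0 u) (t *: e)); apply: has_derive_scale.
  by apply: derivable_has_derive; case: (su [:: ord0]) => _; exact.
have dU (s : R) : 0 < s -> has_derive s 1 U (U1 s).
  by move=> s0; exact: (has_derive_comp (dphi (Num.sqrt s)) (dsqrt s s0)).
have dUp p (s : R) : 0 < s -> has_derive s 1 (fun s => U s `^ p) (p * U s `^ (p - 1) * U1 s).
  move=> s0.
  exact: (@has_derive_comp R (fun t => t `^ p) U s _ _ (has_derive_powR p (u0 _)) (dU s s0)).
have dV : deriv_gt0 V V1 by move=> s s0; exact: dUp.
have [V2 dV1] : exists V2, deriv_gt0 V1 V2.
  exists ('D_1 V1) => s s0; apply: derivable_has_derive.
  have [d dd] := dphi1 (Num.sqrt s).
  have r0 : 2 * Num.sqrt s != 0 by rewrite mulf_neq0 // gt_eqF // sqrtr_gt0.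
  have D2 := @has_derive_inv R R (fun s => 2 * Num.sqrt s) s 1 _ r0
    (has_derive_mul (has_derive_const 2 s 1) (dsqrt s s0)).
  have D1 := @has_derive_comp R phi1 (@Num.sqrt R) s _ _ dd (dsqrt s s0).
  have D3 := has_derive_mul (has_derive_const (- q) s 1) (dUp (- q - 1) s s0).
  by case: (has_derive_mul D3 (has_derive_mul D1 D2)).
pose O : set 'rV[R]_n := [set x | 0 < dotp x x].
have oO : open O.
  apply: (@open_comp _ _ (fun x : 'rV[R]_n => dotp x x) [set t | 0 < t]).
    by move=> x _; exact: dotp_continuous.
  exact: open_gt.
have uV x : O x -> u x `^ (- q) = V (dotp x x).
  move=> Ox; rewrite /V /U; congr (_ `^ _); apply: ru.
  by rewrite enorm_e ?sqrtr_ge0.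
have dVO x (i : 'I_n) : O x ->
  has_derive x (delta_mx 0 i) (fun y => V (dotp y y)) (V1 (dotp x x) * (2 * x 0 i)).
  by move=> Ox; apply: has_derive_radial; exact: dV.
have dV1O x (i : 'I_n) : O x ->
  has_derive x (delta_mx 0 i) (fun y => V1 (dotp y y)) (V2 (dotp x x) * (2 * x 0 i)).
  by move=> Ox; apply: has_derive_radial; exact: dV1.
(* From 3 <= n < 2k it follows that k >= 2, so that sigma_2 is among the positive symmetric
   functions. *)
have k2 : (2 <= k)%N by rewrite -(ltn_pmul2l (isT : 0 < 2)%N) (leq_ltn_trans _ n2k) // ltnW.
apply: (@no_global_profile R V V1 V2 (n%:R / (2 * k%:R)) (1 + rho / (2 * theta))) => //.
- by rewrite ltr_pdivrMr ?mulr_gt0 // mul1r -natrM ltr_nat.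
- suff : rho / (2 * theta) < 1 by lra.
  by rewrite ltr_pdivrMr ?mulr_gt0 // mul1r.
move=> s s0; pose x := Num.sqrt s *: e.
have xs : dotp x x = s by rewrite -sqr_enorm enorm_e ?sqrtr_ge0 // sqr_sqrtr // ltW.
have Ox : O x by rewrite /O /= xs.
have V0 : 0 < V s by apply: powR_gt0; exact: u0.
have sg j : (0 < j <= k)%N -> 0 < sigma_pair n' j (tangential V V1 s) (radial V V1 V2 s).
  move=> jk; have := adm j jk x.
  rewrite (sigma_metric_radial n3 oO dVO dV1O u0 uV) //; last first.
    by case/andP: jk => -> /= jk; apply: leq_trans jk _; case/andP: kn.
  by rewrite xs pmulr_rgt0 // exprn_gt0.
have b0 : 0 < tangential V V1 s.
  apply: (@sigma_pair_pos R n' _ (radial V V1 V2 s)).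
  - by apply: leq_trans (_ : 2 <= n')%N.
  - by apply: sg; rewrite /= (leq_trans _ k2).
  - exact: sg.
have kk : (0 < k <= k)%N by rewrite leqnn andbT; case/andP: kn.
split => //.
- have := sg k kk; rewrite /radial => h0.
  have h : 0 < tangential V V1 s -> 0 < (n'.+1%:R - k%:R) * tangential V V1 s
      + k%:R * (tangential V V1 s + 4 * V2 s * s).
    by move=> bb; rewrite -sigma_pair_gt0.
  (* Positivity of sigma_k is (n - k) b + k (b + 4 s V2) > 0, and the left side is n b + 4 k s V2 =
     2k (gam b + 2 s V2). *)
  have K2 : 0 < 2 * k%:R :> R by rewrite mulr_gt0.
  rewrite -(pmulr_rgt0 _ K2); apply: lt_le_trans (h b0) _.
  rewrite le_eqVlt; apply/orP; left; apply/eqP.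
  by rewrite /n; field; rewrite gt_eqF.
- have := eq_u x; rewrite /=.
  rewrite -/q (sigma_equation_radial oO dVO dV1O u0 uV) // xs.
  have -> : 4 * k%:R * theta / (n%:R + 2 * k%:R) = 2 * theta * q.
    by rewrite /q; field; rewrite gt_eqF.
  rewrite (source_radial oO q0 dVO u0 uV) // xs => E.
  (* The left side of the equation is a power of the positive number sigma_k; hence the right side
     is positive, and its bracket gives y < kap. *)
  have := powR_gt0 (k%:R^-1) (sg k kk); rewrite E.
  rewrite pmulr_lgt0 ?invr_gt0 // => h.
  have -> : 2 * s * V1 s / V s = (4 * theta * (s * V1 s / V s)) / (2 * theta).
    by field; rewrite !gt_eqF.
  rewrite ltr_pdivrMr ?mulr_gt0 //.
  have -> : (1 + rho / (2 * theta)) * (2 * theta) = 2 * theta + rho.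
    by field; rewrite gt_eqF.
  by move: h; lra.
Qed.

End PartOne.

(** * Existence *)

Section PartTwo.
Context {R : realType} {n' : nat}.
Let n := n'.+1.
Variables (k : nat) (theta rho : R).
Hypotheses (n3 : (3 <= n)%N) (kn : (0 < k <= n)%N) (n2k : (n < 2 * k)%N).
Hypotheses (theta0 : 0 < theta) (rho2 : 2 * theta <= rho).

Let K : R := k%:R.
Let q : R := 2 * K / (n%:R + 2 * K).
Let K0 : 0 < K. Proof. by rewrite /K ltr0n; case/andP: kn. Qed.
Let N0 : 0 < n%:R + 2 * K. Proof. by rewrite ltr_wpDr ?mulr_ge0 // ltr0n. Qed.
Let q0 : 0 < q. Proof. by rewrite divr_gt0 // mulr_gt0. Qed.
Let kap : R := 1 + rho / (2 * theta).
Let kap2 : 2 <= kap.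
Proof. by rewrite /kap -lerBlDl ler_pdivlMr ?mulr_gt0 // (_ : 2 - 1 = 1) ?mul1r //; ring. Qed.
Let gam : R := n%:R / (2 * K).

Lemma existence (alpha : R) : 0 < alpha -> exists u : 'rV[R]_n -> R,
  [/\ u 0 = alpha, admissible_solution k theta rho u &
      bigO_pow_at_infty u (- (2 / q))].
Proof.
move=> a0; have [k0 kn'] := andP kn.
pose v0 := alpha `^ (- q); have v00 : 0 < v0 by exact: powR_gt0.
pose c := ('C(n, k)%:R : R) `^ K^-1.
have C0 : 0 < 'C(n, k)%:R :> R by rewrite ltr0n bin_gt0.
have c0 : 0 < c by exact: powR_gt0.
(* With b = 2 V1/(1 + eta) the k-th root of the equation reads c V V1 e^(-Lam/k) = theta (kap + (kap
   - 2) eta), where [c] is the k-th root of the binomial coefficient. This [lam] brings it to the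
   normalized form solved above. *)
pose lam := c * v0 ^+ 2 / theta.
have lam0 : 0 < lam by rewrite divr_gt0 // mulr_gt0 // exprn_gt0.
have [V [V1 [V2 [eta [Lam [CV V0v [dV cV1] [dV1 cV2] [Vpos E1 E2 E3 dec]]]]]]] :=
  radial_solution_exists k0 kn' n2k kap2 v00 lam0.
have cV : cont_ge0 V := Ck_cont (CV 0%N).
pose U s := V s `^ (- q^-1).
have V0 s : 0 <= s -> 0 < V s by move=> /Vpos[].
have d0 (x : 'rV[R]_n) := dotp_ge0 x.
pose u (x : 'rV[R]_n) := U (dotp x x).
have u0 x : 0 < u x by rewrite powR_gt0 // V0.
pose O : set 'rV[R]_n := setT.
have oO : open O by exact: openT.
have uV x : O x -> u x `^ (- q) = V (dotp x x).
  by move=> _; rewrite /u /U -powRrM mulrNN mulVf ?gt_eqF // powRr1 // ltW // V0.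
have dVO x (i : 'I_n) : O x ->
  has_derive x (delta_mx 0 i) (fun y => V (dotp y y)) (V1 (dotp x x) * (2 * x 0 i)).
  by move=> _; exact: has_derive_radial_ge0.
have dV1O x (i : 'I_n) : O x ->
  has_derive x (delta_mx 0 i) (fun y => V1 (dotp y y)) (V2 (dotp x x) * (2 * x 0 i)).
  by move=> _; exact: has_derive_radial_ge0.
have eta1 s : 0 <= s -> 0 < 1 + eta s by move=> /Vpos[_ _ h _]; rewrite ltr_wpDr.
have tanE s : 0 <= s -> tangential V V1 s = 2 * V1 s / (1 + eta s).
  move=> s0; have Vp := V0 s s0; have ep := eta1 s s0; have := E1 s s0 => E.
  have -> : tangential V V1 s = 2 * V1 s * (1 - s * V1 s * (1 + eta s) / (V s * (1 + eta s))).
    by rewrite /tangential; field; rewrite !gt_eqF.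
  by rewrite E; field; rewrite !gt_eqF.
have tan0 s : 0 <= s -> 0 < tangential V V1 s.
  by move=> s0; rewrite tanE // divr_gt0 ?eta1 // mulr_gt0 //; case: (Vpos s s0).
have radE s : 0 <= s -> radial V V1 V2 s =
    tangential V V1 s * (1 - 2 * gam * (1 - expR (- Lam s))).
  move=> s0; have ep := eta1 s s0; rewrite /radial tanE //.
  have -> : 4 * V2 s * s = 4 * (s * V2 s * (1 + eta s)) / (1 + eta s).
    by field; rewrite gt_eqF.
  by rewrite E2 // -/gam; field; rewrite gt_eqF.
(* For j = k the last factor is e^(-Lam), which turns sigma_k into C(n,k) b^k e^(-Lam). For smaller
   j it stays positive since j/k <= 1 and 1 - e^(-Lam) < 1, giving admissibility. *)
have sumE (j : nat) s : 0 <= s ->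
    (n'.+1%:R - j%:R) * tangential V V1 s + j%:R * radial V V1 V2 s =
    n%:R * tangential V V1 s * (1 - j%:R / K * (1 - expR (- Lam s))).
  move=> s0; rewrite radE // /gam; move: (expR _) (tangential _ _ _) => x y.
  by rewrite /n; field; rewrite gt_eqF.
have e01 s : 0 <= s -> 0 < expR (- Lam s) <= 1.
  by move=> s0; rewrite expR_gt0 expR_le1 oppr_le0; case: (Vpos s s0).
exists u; split.
- rewrite /u /U /dotp big1 => [|i _]; last by rewrite !mxE mul0r.
  by rewrite V0v /v0 -powRrM mulrNN divff ?gt_eqF // powRr1 // ltW.
- split=> //.
  + by apply: smooth_radial => j; exact: Ck_powR.
  + by move=> x y xy; rewrite /u -!sqr_enorm xy.
  + move=> x; set s := dotp x x; have s0 : 0 <= s := d0 x.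
    rewrite /= -/K -/q (sigma_equation_radial oO dVO dV1O u0 uV) // -/s.
    have -> : 4 * K * theta / (n%:R + 2 * K) = 2 * theta * q.
      by rewrite /q; field; rewrite gt_eqF.
    rewrite (source_radial oO q0 dVO u0 uV) // -/s.
    have Vp := V0 s s0; have ep := eta1 s s0; have tp := tan0 s s0.
    have -> : sigma_pair n' k (tangential V V1 s) (radial V V1 V2 s) =
        'C(n, k)%:R * tangential V V1 s ^+ k * expR (- Lam s).
      apply: (mulfI (lt0r_neq0 K0)); rewrite /K sigma_pairE // sumE // divff ?gt_eqF //.
      have := mul_bin_diag n k.-1; rewrite prednK // => /(congr1 (fun m => m%:R : R)).
      rewrite !natrM /= => B.
      have Et : tangential V V1 s ^+ k = tangential V V1 s * tangential V V1 s ^+ k.-1.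
        by rewrite -exprS prednK.
      move: (expR _) => z; transitivity (k%:R * 'C(n, k)%:R * tangential V V1 s ^+ k * z).
        by rewrite -B Et /n; ring.
      by ring.
    rewrite !powRM ?mulr_ge0 ?expR_ge0 ?exprn_ge0 ?ltW //.
    rewrite -powR_mulrn ?ltW // -powRrM divff ?gt_eqF // powRr1 ?ltW // -expRM -/c.
    rewrite tanE //.
    have -> : expR (- Lam s / K) = (expR (Lam s / K))^-1 by rewrite mulNr expRN.
    have e3 := E3 s s0; have xp := expR_gt0 (Lam s / K).
    have -> : s * V1 s / V s = eta s / (1 + eta s).
      have -> : s * V1 s / V s = s * V1 s * (1 + eta s) / (V s * (1 + eta s)).
        by field; rewrite !gt_eqF.
      by rewrite E1 //; field; rewrite !gt_eqF.
    have -> : V1 s = v0 ^+ 2 * (kap + (kap - 2) * eta s) * expR (Lam s / K) / (lam * V s).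
      by rewrite -e3; field; rewrite !gt_eqF.
    rewrite /lam /kap; move: (expR _) xp => z z0.
    by field; rewrite !gt_eqF.
  + move=> j jk x; have jn : (0 < j <= n)%N.
      by case/andP: jk => -> /= jk; apply: leq_trans jk _.
    rewrite (sigma_metric_radial n3 oO dVO dV1O u0 uV) //.
    have s0 := d0 x; set s := dotp x x; have tp := tan0 s s0.
    rewrite mulr_gt0 ?exprn_gt0 ?V0 // sigma_pair_gt0 // sumE //.
    rewrite mulr_gt0 ?mulr_gt0 ?ltr0n // subr_gt0.
    have /andP[ep e1] := e01 s s0.
    have jK : j%:R / K <= 1 by rewrite ler_pdivrMr // mul1r ler_nat; case/andP: jk.
    apply: le_lt_trans (_ : 1 - expR (- Lam s) < 1); last by rewrite ltrBlDr ltrDl.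
    by rewrite ler_piMl // subr_ge0.
- have [cc [S [cc0 S0 Hd]]] := dec.
  (* As u = V^(-1/q), the bound V >= cc |x|^2 becomes decay of order |x|^(-2/q). The maximum with 1
     ensures |x|^2 >= |x| >= S. *)
  exists (cc `^ (- q^-1)), (Num.max 1 S); split; first by rewrite lt_max ltr01.
  move=> x; rewrite ge_max => /andP[x1 xS].
  have xp : 0 < enorm x by exact: lt_le_trans x1.
  have sS : S <= dotp x x.
    rewrite -sqr_enorm expr2; apply: le_trans xS _.
    by rewrite ler_peMl // ltW.
  have sp : 0 < dotp x x by exact: lt_le_trans sS.
  rewrite ger0_norm ?(ltW (u0 x)) //.
  have -> : enorm x `^ (- (2 / q)) = dotp x x `^ (- q^-1).
    rewrite -sqr_enorm -powR_mulrn ?(ltW xp) // -powRrM; congr (_ `^ _).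
    by rewrite mulrN.
  rewrite -powRM ?(ltW cc0) ?(ltW sp) // /u /U !powRN.
  rewrite lef_pV2 ?posrE ?powR_gt0 ?mulr_gt0 ?V0 ?(ltW sp) //.
  apply: ge0_ler_powR; rewrite ?nnegrE ?invr_ge0 ?(ltW q0) //.
  + by rewrite mulr_ge0 // ltW.
  + by rewrite ltW // V0 // ltW.
  + exact: Hd.
Qed.

End PartTwo.

Theorem theorem1p4 (R : realType) (n k : nat) (m theta rho : R)
    (hn : (3 <= n)%N) (hk : (1 <= k <= n)%N) (hnk : (n < 2 * k)%N)
    (hm : m = (n%:R - 2 * k%:R) / (n%:R + 2 * k%:R))
    (htheta : 0 < theta) (hrho : 0 < 2 * theta + rho) :
  (rho < 2 * theta ->
     ~ exists u : 'rV[R]_n -> R, admissible_solution k theta rho u)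
  /\
  (2 * theta <= rho ->
     exists u : R -> 'rV[R]_n -> R,
       forall alpha : R, 0 < alpha ->
         [/\ u alpha 0 = alpha,
             admissible_solution k theta rho (u alpha)
           & bigO_pow_at_infty (u alpha) (- (4 / (1 - m)))]).
Proof.
case: n hn hk hnk hm => [//|n] hn hk hnk hm.
split=> [rho_lt|rho_ge]; first exact: nonexistence.
have k0 : 0 < k%:R :> R by rewrite ltr0n; case/andP: hk.
have N0 : 0 < n.+1%:R + 2 * k%:R :> R by rewrite ltr_wpDr ?mulr_ge0 // ltr0n.
(* Here 1 - m = 4k/(n + 2k) = 2q. *)
have -> : 4 / (1 - m) = 2 / (2 * k%:R / (n.+1%:R + 2 * k%:R)).
  rewrite hm; field; rewrite !nat1r (gt_eqF N0) (gt_eqF k0) /=.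
  have -> : n.+1%:R + 2 * k%:R - (n.+1%:R - 2 * k%:R) = 4 * k%:R :> R by ring.
  by rewrite mulf_neq0 ?(gt_eqF k0) // pnatr_eq0.
have H (alpha : R) : exists u : 'rV[R]_n.+1 -> R, 0 < alpha ->
    [/\ u 0 = alpha, admissible_solution k theta rho u &
      bigO_pow_at_infty u (- (2 / (2 * k%:R / (n.+1%:R + 2 * k%:R))))].
  (* Choice needs a function for every real alpha; for alpha <= 0 the requirement is vacuous and the
     zero function is supplied. *)
  have [a0|a0] := ltP 0 alpha; last by exists (fun=> 0).
  by have [u Hu] := existence hn hk hnk htheta rho_ge a0; exists u.
by have [u Hu] := choice H; exists u.
Qed.
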